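(* For every integer $k \ge 3$ and real $\varepsilon > 0$ there exists $r_0 = r_0(k,\varepsilon)$ such that the following holds for all $r \ge r_0$: if $G$ is a graph and $\mathcal{P}$ is a partition of $V(G)$ into $k$ classes, each of size $r$, with $r \ge (2+\varepsilon)\Delta(G)$, then there exists a partition of $V(G)$ into independent transversals of $\mathcal{P}$.
   Context: Given a graph $G$ and a partition $\mathcal{P}=\{V_1,\dots,V_k\}$ of $V(G)$: a transversal of $\mathcal{P}$ is a set $S \subseteq V(G)$ with $|S \cap V_i| = 1$ for every $i\in[k]$; an independent transversal of $\mathcal{P}$ is a transversal of $\mathcal{P}$ that is an independent set in $G$. $\Delta(G)$ is the maximum degree of $G$. *)

(* Defs.v *)
From mathcomp Require Import all_boot.
From Stdlib Require Import Reals.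
Set Implicit Arguments. Unset Strict Implicit. Unset Printing Implicit Defensive.

Definition simple_graph (T : finType) (e : rel T) : Prop :=
  symmetric e /\ irreflexive e.

Definition deg (T : finType) (e : rel T) (v : T) : nat := #|[set u | e v u]|.
Definition maxdeg (T : finType) (e : rel T) : nat := \max_(v : T) deg e v.

(* The partition P = {V_1,...,V_k} is given by a class map part : T -> 'I_k,
   V_i = [set v | part v == i]. *)
Definition part_class (T : finType) (k : nat) (part : T -> 'I_k) (i : 'I_k) : {set T} :=
  [set v | part v == i].

Definition transversal (T : finType) (k : nat) (part : T -> 'I_k) (S : {set T}) : Prop :=
  forall i : 'I_k, #|S :&: part_class part i| = 1%N.

Definition independent (T : finType) (e : rel T) (S : {set T}) : Prop :=
  forall u v, u \in S -> v \in S -> ~~ e u v.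

Definition independent_transversal (T : finType) (e : rel T) (k : nat)
  (part : T -> 'I_k) (S : {set T}) : Prop :=
  transversal part S /\ independent e S.

Definition IT_partition (T : finType) (e : rel T) (k : nat) (part : T -> 'I_k)
  (Q : {set {set T}}) : Prop :=
  partition Q [set: T] /\ forall S, S \in Q -> independent_transversal e part S.

(* Main.v *)
Require Import Defs.
From mathcomp Require Import all_boot all_order all_algebra zify ring lra.
Set Implicit Arguments. Unset Strict Implicit. Unset Printing Implicit Defensive.

(** The heart is a weighted form of Haxell's theorem, due to Aharoni, Berger and
    Ziv: if every class has n >= 2 Delta vertices, every cost c admits an
    independent transversal of cost at most (total cost) / n. It goes by induction
    on the total cost. If the zero-cost vertices contain no independent
    transversal, Haxell's argument yields classes B, a partial transversal Y of all
    of B but one, and a set C of |Y| or fewer centres, such that Y and C dominate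
    every zero-cost vertex of B and each vertex of Y has exactly one neighbour in C.
    Adding to c(v) the number of neighbours of v in Y and C, and subtracting 1 on
    the classes of B, lowers the total by at least n. An independent transversal M
    that is cheap for the new cost and meets Y as much as possible has at least
    |B| - 1 adjacencies with Y and C, so its old cost exceeds its new one by at
    most 1.

    The weighted theorem replaces randomness twice. Independent transversals are
    removed greedily, with costs given by the potential
    sum_v (1 + d(v)/n)^N of the degrees d(v) into what is left: the ratios d(v)/n
    stay below 1/2 until only a small linear number m of vertices per class is left.
    Beforehand, absorbers are set aside in the same way: an absorber for a
    transversal x consists of an independent transversal y and of disjoint sets S_i
    such that S_i + y_i and S_i + x_i are independent transversals for all i, and a
    potential summing 2^(- number of absorbers for x) makes every x absorbed by at
    least m of them. *)

(** * Haxell's domination certificate *)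

Definition nbr (T : finType) (e : rel T) (v : T) : {set T} := [set u | e v u].

Definition indep (T : finType) (e : rel T) (S : {set T}) : bool :=
  [forall u in S, forall v in S, ~~ e u v].

Lemma indepP (T : finType) (e : rel T) (S : {set T}) :
  reflect (independent e S) (indep e S).
Proof.
apply: (iffP forall_inP) => [h u v uS vS | h u uS].
  by move/forall_inP: (h u uS); apply.
by apply/forall_inP => v vS; apply: h.
Qed.

(** Boolean, so that extremal transversals can be selected. [Z] and [I] are parameters because the
    arguments below delete vertices and discard or merge classes. *)
Definition is_IT (T K : finType) (e : rel T) (p : T -> K) (Z : {set T})
    (I : {set K}) (S : {set T}) : bool :=
  [&& S \subset Z, indep e S, dinjectiveb p S & p @: S == I].

Lemma is_ITP (T K : finType) (e : rel T) (p : T -> K) (Z : {set T})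
    (I : {set K}) (S : {set T}) :
  reflect [/\ S \subset Z, independent e S, {in S &, injective p} & p @: S = I]
          (is_IT e p Z I S).
Proof.
apply: (iffP and4P) => [[? /indepP ? /dinjectiveP ? /eqP ?]|[? ? ? ?]]; split=> //.
- exact/indepP.
- exact/dinjectiveP.
- exact/eqP.
Qed.

(* Induction on the number of classes. Pick v in class r and a T covering the other
   classes with as few neighbours of v as possible; merging the classes met by
   N(v) :&: T into r and deleting everything dominated by v and N(v) :&: T leaves a
   system that still has no independent transversal, by minimality of T. *)
Lemma haxell_certificate (T K : finType) (e : rel T) (p : T -> K)
    (Z : {set T}) (I : {set K}) (r : K) (T0 : {set T}) :
  symmetric e -> irreflexive e -> r \in I -> is_IT e p Z (I :\ r) T0 ->
  (forall S, ~~ is_IT e p Z I S) ->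
  exists B : {set K}, exists Y C : {set T},
  [/\ [/\ r \in B, B \subset I & is_IT e p Z (B :\ r) Y],
      [/\ C \subset Z, [disjoint C & Y] & #|C| <= #|Y|],
      forall y, y \in Y -> #|nbr e y :&: C| = 1
    & forall z, z \in Z -> p z \in B -> exists2 d, d \in Y :|: C & e z d].
Proof.
move=> esym eirr; have [n] := ubnP #|I|.
elim: n p Z I T0 => // n IHn p Z I T0 /ltnSE leIn rI IT0 noIT.
have [Zr0|[v]] := set_0Vmem [set z in Z | p z == r].
  exists [set r], set0, set0; split.
  - split; rewrite ?set11 ?sub1set //; apply/is_ITP; split; rewrite ?sub0set //.
    + by move=> u w; rewrite inE.
    + by move=> u w; rewrite inE.
    + by rewrite imset0 setDv.
  - by rewrite sub0set cards0 disjoints_subset sub0set.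
  - by move=> y; rewrite inE.
  - move=> z zZ; rewrite inE => pz; have: z \in set0 by rewrite -Zr0 inE zZ.
    by rewrite inE.
rewrite inE => /andP[vZ /eqP pv].
case: (arg_minnP (fun S => #|nbr e v :&: S|) IT0) => S IS Smin.
move/is_ITP: (IS) => [SZ Sind Sinj Sim].
pose TA := nbr e v :&: S; pose A := p @: TA.
have TAS : TA \subset S by apply: subsetIr.
have AI : A \subset I :\ r by rewrite -Sim; apply: imsetS.
have rA : r \notin A.
  by apply/negP => /(subsetP AI); rewrite !inE eqxx.
have inA t : t \in S -> (p t \in A) = (t \in TA).
  move=> tS; apply/imsetP/idP => [[t' t'A ptt']|tA]; last by exists t.
  by rewrite (Sinj t t') // (subsetP TAS).
have A0 : A != set0.
  apply/negP => /eqP A0; have TA0 : TA = set0 by apply/eqP; rewrite -(imset_eq0 p) -/A A0.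
  have vS t : t \in S -> ~~ e v t.
    move=> tS; apply/negP => evt.
    by have: t \in TA; [rewrite !inE evt | rewrite TA0 inE].
  move/negP: (noIT (v |: S)); apply; apply/is_ITP; split.
  - by rewrite subUset sub1set vZ.
  - move=> u w; rewrite !inE => /orP[/eqP->|uS] /orP[/eqP->|wS]; rewrite ?eirr ?vS //.
      by rewrite esym vS.
    exact: Sind.
  - have neq t : t \in S -> p t != r.
      by move=> tS; have: p t \in p @: S; [exact: imset_f | rewrite Sim !inE => /andP[]].
    move=> u w; rewrite !inE => /orP[/eqP->|uS] /orP[/eqP->|wS] // E.
    + by move: (neq w wS); rewrite -E pv eqxx.
    + by move: (neq u uS); rewrite E pv eqxx.
    + exact: Sinj.
  - by rewrite imsetU1 Sim pv setD1K.
pose D1 := v |: TA.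
pose Z' := [set z in Z | [forall d in D1, ~~ e d z]].
pose p' x := if p x \in A then r else p x.
pose I' := I :\: A.
have Z'Z : Z' \subset Z by apply/subsetP => z; rewrite inE => /andP[].
have Z'D z d : z \in Z' -> d \in D1 -> ~~ e d z.
  by rewrite inE => /andP[_ /forall_inP]; apply.
have rI' : r \in I' by rewrite inE rA.
have p'E x : p' x != r -> p' x = p x.
  by rewrite /p'; case: ifP => //; rewrite eqxx.
have ltI' : #|I'| < n.
  apply: leq_trans leIn; apply: proper_card; apply/properP; split; first exact: subsetDl.
  case/set0Pn: A0 => a aA; exists a; last by rewrite inE aA.
  by move/subsetP: AI => /(_ a aA); rewrite inE => /andP[].
have IT1 : is_IT e p' Z' (I' :\ r) (S :\: TA).
  apply/is_ITP; split.
  - apply/subsetP => t; rewrite !inE => /andP[tTA tS]; rewrite (subsetP SZ) //=.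
    apply/forall_inP => d; rewrite !inE => /orP[/eqP->|/andP[_ dS]].
      by move: tTA; rewrite tS andbT.
    exact: Sind.
  - by move=> u w; rewrite !inE => /andP[_ uS] /andP[_ wS]; apply: Sind.
  - move=> u w; rewrite !in_setD => /andP[uA uS] /andP[wA wS].
    by rewrite /p' !inA // (negbTE uA) (negbTE wA); apply: Sinj.
  - apply/setP => i; apply/imsetP/idP => [[t]|].
      rewrite in_setD => /andP[tA tS] ->; rewrite /p' inA // (negbTE tA) in_setD1 in_setD inA // tA /=.
      by have: p t \in p @: S; [exact: imset_f | rewrite Sim in_setD1].
    rewrite !inE => /and3P[ir iA iI].
    have: i \in p @: S by rewrite Sim !inE ir.
    case/imsetP => t tS Ei; exists t; last by rewrite /p' -Ei (negbTE iA).
    by rewrite in_setD tS andbT -inA // -Ei.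
(* Let [x] be the vertex of [S1] in the merged class. If [p x = r], then [TA :|: S1] is an
   independent transversal of all of [I]. Otherwise [x] lies in the class of some [t] in [TA], and
   [(TA :\ t) :|: S1] covers [I :\ r] with fewer neighbours of [v] than [S], since [S1] has none. *)
have noIT' S1 : ~~ is_IT e p' Z' I' S1.
  apply/negP => /is_ITP[S1Z' S1ind S1inj S1im].
  have S1Z := subset_trans S1Z' Z'Z.
  have S1TA s t : s \in S1 -> t \in TA -> ~~ e t s.
    by move=> sS tT; apply: Z'D (subsetP S1Z' _ sS) _; rewrite inE tT orbT.
  have S1v s : s \in S1 -> ~~ e v s.
    by move=> sS; apply: Z'D (subsetP S1Z' _ sS) _; rewrite !inE eqxx.
  have [x xS1 p'x] : exists2 x, x \in S1 & r = p' x by apply/imsetP; rewrite S1im.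
  have other s : s \in S1 -> s != x -> [/\ p' s = p s, p s \in I', p s != r & p s \notin A].
    move=> sS sx; have nr : p' s != r.
      by apply/negP => /eqP; rewrite p'x => /(S1inj _ _ sS xS1)/eqP; rewrite (negbTE sx).
    have p'I : p' s \in I' by rewrite -S1im imset_f.
    rewrite -(p'E _ nr); split=> //.
    by move: p'I; rewrite in_setD => /andP[].
  have onto i : i \in I' -> i != r -> exists2 s, s \in S1 :\ x & p s = i.
    rewrite -S1im => /imsetP[s sS Ei] ir; have sx : s != x.
      by apply/negP => /eqP E; rewrite Ei E -p'x eqxx in ir.
    by exists s; rewrite ?inE ?sx //; case: (other s sS sx) => <-.
  have indU (W : {set T}) : W \subset TA -> independent e (W :|: S1).
    move=> /subsetP WT u w; rewrite !inE => /orP[uW|uS] /orP[wW|wS].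
    - by apply: Sind; apply: (subsetP TAS); apply: WT.
    - by apply: S1TA => //; apply: WT.
    - by rewrite esym; apply: S1TA => //; apply: WT.
    - exact: S1ind.
  have [pxA|pxA] := boolP (p x \in A); last first.
    have pxr : p x = r by rewrite p'x /p' (negbTE pxA).
    move/negP: (noIT (TA :|: S1)); apply; apply/is_ITP; split.
    - by rewrite subUset S1Z andbT (subset_trans TAS).
    - exact: indU.
    - have S1nA s : s \in S1 -> p s \notin A.
        by move=> sS; have [->//|sx] := eqVneq s x; case: (other s sS sx).
      have p'p s : s \in S1 -> p' s = p s by move/S1nA/negbTE; rewrite /p' => ->.
      move=> u w; rewrite !in_setU => /orP[uW|uS] /orP[wW|wS] E.
      + by apply: Sinj => //; apply: (subsetP TAS).
      + by move: (S1nA w wS); rewrite -E imset_f.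
      + by move: (S1nA u uS); rewrite E imset_f.
      + by apply: S1inj; rewrite ?p'p.
    - apply/setP => i; apply/imsetP/idP => [[s]|iI].
        rewrite in_setU => /orP[sT|sS] ->.
          by have: p s \in A; [exact: imset_f | move/(subsetP AI); rewrite inE => /andP[]].
        have [->|sx] := eqVneq s x; first by rewrite pxr.
        by case: (other s sS sx) => _; rewrite inE => /andP[].
      have [iA|iA] := boolP (i \in A).
        by case/imsetP: iA => t tT ->; exists t; rewrite // inE tT.
      have [->|ir] := eqVneq i r; first by exists x; rewrite ?inE ?xS1 ?orbT.
      have [|s] := onto i _ ir; first by rewrite inE iA.
      by rewrite !inE => /andP[_ sS] <-; exists s; rewrite // inE sS orbT.
  case/imsetP: (pxA) => t tT pxt.
  have tS := subsetP TAS t tT.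
  have IS2 : is_IT e p Z (I :\ r) ((TA :\ t) :|: S1).
    have nt s : s \in TA :\ t -> p s != p x.
      rewrite !inE => /andP[st /andP[_ sS]]; rewrite pxt.
      by apply/negP => /eqP /(Sinj _ _ sS tS)/eqP; rewrite (negbTE st).
    apply/is_ITP; split.
    - by rewrite subUset S1Z andbT (subset_trans (subsetDl _ _)) // (subset_trans TAS).
    - exact/indU/subsetDl.
    - move=> u w; rewrite !in_setU => /orP[uW|uS] /orP[wW|wS] E.
      + by move: uW wW; rewrite !inE => /andP[_ /andP[_ uS]] /andP[_ /andP[_ wS]]; apply: Sinj.
      + have [wx|wx] := eqVneq w x; first by move: (nt _ uW); rewrite E wx eqxx.
        have [_ _ _] := other w wS wx; rewrite -E imset_f //.
        by apply: (subsetP (subsetDl _ _) _ uW).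
      + have [ux|ux] := eqVneq u x; first by move: (nt _ wW); rewrite -E ux eqxx.
        have [_ _ _] := other u uS ux; rewrite E imset_f //.
        by apply: (subsetP (subsetDl _ _) _ wW).
      + have [ux|ux] := eqVneq u x; have [wx|wx] := eqVneq w x.
        * by rewrite ux wx.
        * by have [_ _ _] := other w wS wx; rewrite -E ux pxA.
        * by have [_ _ _] := other u uS ux; rewrite E wx pxA.
        * apply: S1inj => //; have [-> _ _ _] := other u uS ux.
          by have [-> _ _ _] := other w wS wx.
    - apply/setP => i; apply/imsetP/idP => [[s]|].
        rewrite in_setU => /orP[sT|sS] ->.
          by apply: (subsetP AI); rewrite imset_f //; apply: (subsetP (subsetDl _ _) _ sT).
        have [->|sx] := eqVneq s x; first by apply: (subsetP AI).
        by case: (other s sS sx) => _ + + _; rewrite in_setD1 in_setD => /andP[_ ->] ->.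
      rewrite in_setD1 => /andP[ir iI].
      have [iA|iA] := boolP (i \in A).
        case/imsetP: iA => s sT ->; have [->|st] := eqVneq s t.
          by exists x; rewrite // inE xS1 orbT.
        by exists s; rewrite // in_setU in_setD1 st sT.
      have [|s] := onto i _ ir; first by rewrite inE iA.
      by rewrite !inE => /andP[_ sS] <-; exists s; rewrite // inE sS orbT.
  have := Smin _ IS2; apply/negP; rewrite -ltnNge.
  apply: proper_card; apply/properP; split.
    apply/subsetP => s; rewrite in_setI in_setU inE => /andP[evs /orP[]].
      by move/(subsetP (subsetDl _ _)).
    by move/S1v; rewrite evs.
  exists t => //; rewrite !inE eqxx /= negb_and; apply/orP; right.
  by apply/negP => /S1v; move: tT; rewrite !inE => /andP[->].
have [B [Y [C [[rB BI' IY] [CZ CY cCY] deg1 dom]]]] := IHn p' Z' I' _ ltI' rI' IT1 noIT'.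
move/is_ITP: (IY) => [YZ' Yind Yinj Yim].
have BI : B \subset I by apply: subset_trans BI' (subsetDl _ _).
have p'Y y : y \in Y -> p' y = p y /\ p y \in B :\ r.
  move=> yY; have: p' y \in B :\ r by rewrite -Yim imset_f.
  by move=> h; move: (h); rewrite in_setD1 => /andP[/p'E Ey _]; rewrite -Ey.
have BA i : i \in B -> i \notin A.
  by move/(subsetP BI'); rewrite inE => /andP[].
have TAY : [disjoint TA & Y].
  rewrite disjoint_subset; apply/subsetP => t tT; rewrite inE; apply/negP => /p'Y[_].
  by rewrite in_setD1 => /andP[_ /BA]; rewrite imset_f.
have vZ' : v \notin Z'.
  apply/negP => /Z'D h; case/set0Pn: A0 => _ /imsetP[t tT _].
  have: ~~ e t v by apply: h; rewrite inE tT orbT.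
  by rewrite esym; move: tT; rewrite !inE => /andP[->].
have vC : v \notin C by apply: contra vZ' => /(subsetP CZ).
(* Degrees into the centres stay 1: vertices of [TA] see [v] and nothing in [C], as [C] lies in
   [Z']; vertices of [Y] lie in [Z'] too and do not see [v]. One new centre is paid for by [TA],
   which is nonempty. *)
exists (B :|: A), (TA :|: Y), (v |: C); split.
- split; first by rewrite inE rB.
    by rewrite subUset BI (subset_trans AI) ?subsetDl.
  apply/is_ITP; split.
  + by rewrite subUset (subset_trans TAS) // (subset_trans YZ').
  + move=> u w; rewrite !in_setU => /orP[uT|uY] /orP[wT|wY].
    * by apply: Sind; apply: (subsetP TAS).
    * by apply: Z'D (subsetP YZ' _ wY) _; rewrite inE uT orbT.
    * by rewrite esym; apply: Z'D (subsetP YZ' _ uY) _; rewrite inE wT orbT.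
    * exact: Yind.
  + move=> u w; rewrite !in_setU => /orP[uT|uY] /orP[wT|wY] E.
    * by apply: Sinj => //; apply: (subsetP TAS).
    * by have [_] := p'Y w wY; rewrite inE => /andP[_ /BA]; rewrite -E imset_f.
    * by have [_] := p'Y u uY; rewrite inE => /andP[_ /BA]; rewrite E imset_f.
    * by apply: Yinj => //; have [-> _] := p'Y u uY; have [-> _] := p'Y w wY.
  + rewrite imsetU setDUl; have -> : A :\ r = A by apply/setDidPl; rewrite disjoint_sym disjoints1.
    rewrite setUC; congr (_ :|: _); rewrite -Yim.
    by apply: eq_in_imset => y /p'Y[].
- split.
  + by rewrite subUset sub1set vZ (subset_trans CZ).
  + rewrite disjoint_subset; apply/subsetP => c; rewrite in_setU1 inE in_setU negb_or.
    case/orP => [/eqP->|cC].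
      by rewrite !inE eirr; apply: contra vZ' => /(subsetP YZ').
    rewrite (disjointFr CY cC) andbT; apply/negP => cT.
    move/(subsetP CZ)/Z'D: cC => /(_ v); rewrite setU11 => /(_ isT).
    by move: cT; rewrite !inE => /andP[->].
  + rewrite cardsU1 vC cardsU (eqP (_ : TA :&: Y == set0)) ?setI_eq0 // cards0 subn0.
    rewrite leq_add // card_gt0; apply: contra A0 => /eqP E.
    by rewrite /A E imset0.
- move=> y; rewrite in_setU => /orP[yT|yY].
  + have -> : nbr e y :&: (v |: C) = [set v]; last by rewrite cards1.
    apply/setP => c; rewrite !inE; have [->|cv] /= := eqVneq c v.
      by rewrite andbT esym; move: yT; rewrite !inE => /andP[->].
    apply/negP => /andP[eyc cC]; have: ~~ e y c; last by rewrite eyc.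
    by apply: Z'D (subsetP CZ _ cC) _; rewrite inE yT orbT.
  + have -> : nbr e y :&: (v |: C) = nbr e y :&: C; last exact: deg1.
    apply/setP => c; rewrite !inE; have [->|//] := eqVneq c v.
    rewrite (negbTE vC) andbF; apply/negbTE; rewrite andbT esym.
    by apply: Z'D (subsetP YZ' _ yY) _; rewrite !inE eqxx.
- move=> z zZ pzBA; have [zZ'|] := boolP (z \in Z').
    have p'z : p' z \in B.
      rewrite /p'; case: ifP => // pzA; move: pzBA; rewrite inE pzA orbF.
      by [].
    have [d dD ezd] := dom z zZ' p'z; exists d => //.
    by move: dD; rewrite !in_setU => /orP[->|->]; rewrite ?orbT.
  rewrite inE zZ /= negb_forall => /existsP[d]; rewrite negb_imply negbK => /andP[dD edz].
  exists d; last by rewrite esym.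
  by move: dD; rewrite !in_setU !in_set1 => /orP[->|->]; rewrite ?orbT.
Qed.

(** * Weighted independent transversals *)

Lemma sum_nbr_sym (T : finType) (e : rel T) (A B : {set T}) :
  symmetric e ->
  \sum_(v in A) #|nbr e v :&: B| = \sum_(d in B) #|nbr e d :&: A|.
Proof.
move=> esym.
have cnt v (X : {set T}) : #|nbr e v :&: X| = \sum_(u in X) e v u.
  rewrite -sum1_card [RHS]big_mkcond [LHS]big_mkcond /=; apply: eq_bigr => u _.
  by rewrite !inE; case: (e v u); case: (u \in X).
rewrite (eq_bigr _ (fun v _ => cnt v B)) exchange_big.
by apply: eq_bigr => d _; rewrite cnt; apply: eq_bigr => v _; rewrite esym.
Qed.

(** A smallest family of classes without an independent transversal acquires one as soon as any
    class is dropped. This provides the starting point of [haxell_certificate]. *)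
Lemma minimal_no_IT (T K : finType) (e : rel T) (p : T -> K) (Z : {set T}) (I : {set K}) :
  (forall S, ~~ is_IT e p Z I S) ->
  exists I0 : {set K}, exists r, exists T0 : {set T},
  [/\ I0 \subset I, r \in I0, is_IT e p Z (I0 :\ r) T0 & forall S, ~~ is_IT e p Z I0 S].
Proof.
move=> noIT; pose P (J : {set K}) := (J \subset I) && [forall S, ~~ is_IT e p Z J S].
have PI : P I by rewrite /P subxx; apply/forallP.
case: (arg_minnP (fun J : {set K} => #|J|) PI) => I0 /andP[I0I /forallP no0] I0min.
have [I00|[r rI0]] := set_0Vmem I0.
  case/negP: (no0 set0); apply/is_ITP; rewrite sub0set imset0 I00.
  by split=> // u w; rewrite inE.
have: ~~ P (I0 :\ r).
  by apply/negP => /I0min; rewrite leqNgt [X in _ < X](cardsD1 r) rI0 ltnS leqnn.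
rewrite negb_and (subset_trans (subsetDl _ _) I0I) /= negb_forall => /existsP[T0].
by rewrite negbK => IT0; exists I0, r, T0.
Qed.

(** The size condition bounds unions of classes, with [2 * D] per class beyond the first, and not
    each class separately. It thus survives deleting a whole neighbourhood, which may fall into a
    single class. *)
Theorem weighted_IT (T K : finType) (e : rel T) (p : T -> K) (U : {set T})
    (I : {set K}) (D n : nat) (c : T -> nat) :
  symmetric e -> irreflexive e -> 0 < n ->
  (forall v, v \in U -> #|nbr e v :&: U| <= D) ->
  (forall B : {set K}, B != set0 -> B \subset I ->
     2 * D * (#|B|).-1 + n <= #|[set v in U | p v \in B]|) ->
  exists2 S, is_IT e p U I S & n * \sum_(v in S) c v <= \sum_(v in U) c v.
Proof.
move=> esym eirr n0 degU sizeU.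
have [N] := ubnP (\sum_(v in U) c v); elim: N c => // N IHN c /ltnSE leN.
pose Z := [set v in U | c v == 0].
have ZU : Z \subset U by apply/subsetP => v; rewrite inE => /andP[].
have [/existsP[S IS]|] := boolP [exists S, is_IT e p Z I S].
  case/is_ITP: IS => SZ Sind Sinj Sim; exists S.
    by apply/is_ITP; split=> //; apply: subset_trans ZU.
  by rewrite big1 ?muln0 // => v /(subsetP SZ); rewrite inE => /andP[_ /eqP].
rewrite negb_exists => /forallP/minimal_no_IT[I0 [r [T0 [I0I rI0 IT0 no0]]]].
have [B [Y [C [[rB BI0 /is_ITP[YZ Yind Yinj Yim]] [CZ CY cCY] deg1 dom]]]] :=
  haxell_certificate esym eirr rI0 IT0 no0.
have BI := subset_trans BI0 I0I.
have B0 : B != set0 by apply/set0Pn; exists r.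
have cY : #|Y| = #|B|.-1.
  by rewrite -(card_in_imset Yinj) Yim [in RHS](cardsD1 r) rB.
have YU := subset_trans YZ ZU; have CU := subset_trans CZ ZU.
pose h v := #|nbr e v :&: Y| + #|nbr e v :&: C|.
pose UB : {set T} := [set v in U | p v \in B].
pose c' v := c v + h v - (p v \in B).
(* The truncated subtraction in [c'] is exact: a vertex of cost 0 in a class of [B] is dominated by
   [Y :|: C], so [h v] is at least 1. *)
have c'E v : v \in U -> c' v + (p v \in B) = c v + h v.
  move=> vU; apply: subnK; case: (boolP (p v \in B)) => //= pB.
  case: (posnP (c v)) => [cv0|]; last by move=> cv; rewrite addn_gt0 cv.
  have [|d dYC evd] := dom v _ pB; first by rewrite inE vU cv0.
  rewrite cv0 /h add0n addn_gt0 !card_gt0; move: dYC; rewrite inE => /orP[dY|dC].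
    by apply/orP; left; apply/set0Pn; exists d; rewrite !inE evd.
  by apply/orP; right; apply/set0Pn; exists d; rewrite !inE evd.
have c'Y y : y \in Y -> c' y = 0.
  move=> yY; move: (yY) => /(subsetP YZ); rewrite inE => /andP[yU /eqP cy0].
  have pyB : p y \in B by have: p y \in p @: Y; [exact: imset_f | rewrite Yim inE => /andP[]].
  rewrite /c' pyB cy0 /h deg1 // (_ : _ :&: _ = set0) ?cards0 //.
  apply/setP => u; rewrite !inE; apply/negP => /andP[eyu uY].
  by move: (Yind y u yY uY); rewrite eyu.
have sumh : \sum_(v in U) h v <= 2 * D * (#|B|).-1.
  have bnd (X : {set T}) : X \subset U -> \sum_(v in U) #|nbr e v :&: X| <= D * #|X|.
    move=> XU; rewrite sum_nbr_sym // mulnC -sum_nat_const.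
    by apply: leq_sum => d /(subsetP XU); apply: degU.
  rewrite big_split /=; apply: leq_trans (leq_add (bnd Y YU) (bnd C CU)) _.
  by rewrite -mulnDr (mulnC 2) -mulnA leq_mul2l -cY mul2n -addnn leq_add2l cCY orbT.
have sumUB : \sum_(v in U) (p v \in B : nat) = #|UB|.
  rewrite -sum1_card [RHS]big_mkcond [LHS]big_mkcond; apply: eq_bigr => v _.
  by rewrite inE; case: (v \in U); case: (p v \in B).
have sumc' : \sum_(v in U) c' v + n <= \sum_(v in U) c v.
  have E : \sum_(v in U) c' v + #|UB| = \sum_(v in U) c v + \sum_(v in U) h v.
    by rewrite -sumUB -!big_split; apply: eq_bigr.
  have sB := sizeU B B0 BI; rewrite -(leq_add2r #|UB|) -addnA (addnC n) addnA E -addnA leq_add2l.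
  by apply: leq_trans sB; rewrite leq_add2r.
have [|M0 IM0 cM0] := IHN c'.
  by apply: leq_trans leN; apply: leq_trans sumc'; rewrite -addn1 leq_add2l.
pose Q (M : {set T}) := is_IT e p U I M && (n * \sum_(v in M) c' v <= \sum_(v in U) c' v).
have QM0 : Q M0 by rewrite /Q IM0.
case: (arg_maxnP (fun M => #|M :&: Y|) QM0) => M /andP[IM cM] Mmax {M0 IM0 cM0 QM0}.
case/is_ITP: (IM) => MU Mind Minj Mim.
(* Otherwise y, which has new cost 0, could replace the vertex of M in its class. *)
have domY y : y \in Y :\: M -> 0 < #|nbr e y :&: M|.
  rewrite inE => /andP[yM yY]; rewrite lt0n; apply/negP => /eqP/cards0_eq y0.
  have yNM u : u \in M -> ~~ e y u.
    by move=> uM; apply/negP => eyu; move/setP/(_ u): y0; rewrite !inE eyu uM.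
  have pyI : p y \in I.
    by apply: (subsetP BI); have: p y \in p @: Y; [exact: imset_f | rewrite Yim inE => /andP[]].
  have [m mM pm] : exists2 m, m \in M & p y = p m by apply/imsetP; rewrite Mim.
  have mY : m \notin Y.
    by apply: contra yM => mY; rewrite (Yinj y m).
  pose M' := y |: M :\ m.
  have inM' u : u \in M' -> u = y \/ u \in M /\ u != m.
    by rewrite !inE => /orP[/eqP|/andP[? ?]]; [left|right].
  have QM' : Q M'.
    apply/andP; split; last first.
      rewrite big_setU1 /=; last by rewrite inE negb_and yM orbT.
      rewrite c'Y // add0n; apply: leq_trans cM; rewrite leq_mul2l.
      by rewrite [X in _ <= X](big_setD1 m) //= leq_addl orbT.
    apply/is_ITP; split.
    - by rewrite subUset sub1set (subsetP YU) // (subset_trans (subsetDl _ _)).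
    - move=> u w /inM'[->|[uM um]] /inM'[->|[wM wm]].
      + by rewrite eirr.
      + exact: yNM.
      + by rewrite esym yNM.
      + exact: Mind.
    - move=> u w /inM'[->|[uM um]] /inM'[->|[wM wm]] // E.
      + by case/eqP: wm; apply: Minj; rewrite // -E.
      + by case/eqP: um; apply: Minj; rewrite // E.
      + exact: Minj.
    - by rewrite imsetU1 pm -imsetU1 setD1K.
  have := Mmax M' QM'; apply/negP; rewrite -ltnNge; apply: proper_card.
  apply/properP; split; last by exists y; rewrite !inE ?eqxx ?yY // (negbTE yM).
  apply/subsetP => u; rewrite !inE => /andP[uM uY]; rewrite uM uY !andbT.
  by apply/orP; right; apply: contra mY => /eqP <-.
(* Each [y] in [Y] is charged once: outside [M] it has a neighbour in [M] by [domY]; inside [M] it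
   is adjacent to its centre in [C]. *)
have hits : #|B|.-1 <= \sum_(v in M) h v.
  rewrite -cY -(cardsID M Y) addnC big_split /=; apply: leq_add.
    rewrite sum_nbr_sym // [X in _ <= X](big_setID M) /= -sum1_card.
    apply: leq_trans (leq_addl _ _).
    by apply: leq_sum => y yD; apply: domY.
  rewrite [X in _ <= X](big_setID Y) /=; apply: leq_trans (leq_addr _ _).
  rewrite setIC -sum1_card; apply: leq_sum => y; rewrite inE => /andP[_ yY].
  by rewrite deg1.
have cMB : \sum_(v in M) c v <= (\sum_(v in M) c' v).+1.
  have E : \sum_(v in M) c' v + \sum_(v in M) (p v \in B : nat) =
           \sum_(v in M) c v + \sum_(v in M) h v.
    by rewrite -!big_split; apply: eq_bigr => v /(subsetP MU)/c'E.
  suff EB : \sum_(v in M) (p v \in B : nat) = #|B|.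
    rewrite -(leq_add2r #|B|.-1); apply: leq_trans (leq_add (leqnn _) hits) _.
    by rewrite -E EB addSn -addnS prednK ?card_gt0.
  have -> : B = p @: [set v in M | p v \in B].
    apply/setP => i; apply/idP/imsetP => [iB|[v]].
      have: i \in p @: M by rewrite Mim (subsetP BI).
      by case/imsetP => v vM E'; exists v; rewrite // inE vM -E'.
    by rewrite inE => /andP[_ vB] ->.
  rewrite card_in_imset; last first.
    by move=> u w; rewrite !inE => /andP[uM _] /andP[wM _]; apply: Minj.
  rewrite -sum1_card [RHS]big_mkcond [LHS]big_mkcond; apply: eq_bigr => v _.
  have -> : [set p x | x in [set v0 in M | p v0 \in B]] = B.
    apply/setP => i; apply/imsetP/idP => [[u]|iB].
      by rewrite inE => /andP[_ uB] ->.
    have: i \in p @: M by rewrite Mim (subsetP BI).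
    by case/imsetP => u uM E'; exists u; rewrite // inE uM -E'.
  by rewrite inE; case: (v \in M); case: (p v \in B).
exists M => //; apply: leq_trans sumc'; apply: leq_trans (leq_add cM (leqnn n)).
by rewrite addnC -mulnS leq_mul2l cMB orbT.
Qed.

(** * Absorbers *)

Definition class (T K : finType) (p : T -> K) (U : {set T}) (i : K) : {set T} :=
  [set v in U | p v == i].

(** Only the number and the union of the transversals are recorded, so disjoint packings simply add
    up. The blocks are recovered at the end by [packing_partition]. *)
Inductive packing (T K : finType) (e : rel T) (p : T -> K) : nat -> {set T} -> Prop :=
| packing0 : packing e p 0 set0
| packingS m (S U : {set T}) : is_IT e p setT setT S -> [disjoint S & U] ->
    packing e p m U -> packing e p m.+1 (S :|: U).

Lemma packing1 (T K : finType) (e : rel T) (p : T -> K) (S : {set T}) :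
  is_IT e p setT setT S -> packing e p 1 S.
Proof.
move=> IS; rewrite -(setU0 S); apply: packingS => //; last exact: packing0.
by rewrite disjoints_subset setC0 subsetT.
Qed.

Lemma packingU (T K : finType) (e : rel T) (p : T -> K) (m n : nat) (U W : {set T}) :
  packing e p m U -> packing e p n W -> [disjoint U & W] ->
  packing e p (m + n) (U :|: W).
Proof.
elim=> [|{}m S {}U IS SU _ IH] pW; first by rewrite set0U.
rewrite disjoints_subset subUset -!disjoints_subset => /andP[SW UW].
rewrite -setUA addSn; apply: packingS => //; last exact: IH.
by rewrite -setI_eq0 setIUr setU_eq0 !setI_eq0 SU.
Qed.

Lemma card_class_IT (T K : finType) (e : rel T) (p : T -> K) (Z : {set T})
    (I : {set K}) (S : {set T}) (i : K) :
  is_IT e p Z I S -> #|class p S i| = (i \in I).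
Proof.
case/is_ITP => _ _ inj im; have [|iI] := boolP (i \in I).
  rewrite -im => /imsetP[v vS ->]; rewrite (_ : class p S (p v) = [set v]) ?cards1 //.
  apply/setP => u; rewrite !inE; apply/andP/eqP => [[uS /eqP pu]|->]; last by rewrite eqxx.
  exact: inj.
apply/eqP; rewrite cards_eq0; apply/eqP/setP => u; rewrite !inE.
by apply/negP => /andP[uS /eqP pu]; rewrite -im -pu imset_f in iI.
Qed.

Lemma card_classU (T K : finType) (p : T -> K) (U W : {set T}) (i : K) :
  #|class p (U :|: W) i| <= #|class p U i| + #|class p W i|.
Proof.
apply: leq_trans (leq_card_setU _ _); apply: subset_leq_card.
by apply/subsetP => v; rewrite !inE andb_orl.
Qed.

Lemma card_class_disjU (T K : finType) (p : T -> K) (U W : {set T}) (i : K) :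
  [disjoint U & W] -> #|class p (U :|: W) i| = #|class p U i| + #|class p W i|.
Proof.
move=> UW; rewrite -[RHS]subn0 -(cards0 T) -cardsUI.
have -> : class p U i :&: class p W i = set0.
  apply/setP => v; rewrite !inE; apply/negP => /andP[/andP[vU _] /andP[vW _]].
  by rewrite (disjointFr UW vU) in vW.
rewrite cards0 addn0 subn0; apply: eq_card => v.
by rewrite !inE andb_orl.
Qed.

Lemma card_classD (T K : finType) (p : T -> K) (U W : {set T}) (i : K) :
  #|class p U i| <= #|class p (U :\: W) i| + #|class p W i|.
Proof.
apply: leq_trans (card_classU _ _ _ _); apply: subset_leq_card.
by apply/subsetP => v; rewrite !inE => /andP[-> ->]; case: (v \in W).
Qed.

Lemma card_class_packing (T K : finType) (e : rel T) (p : T -> K) (m : nat)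
    (U : {set T}) (i : K) :
  packing e p m U -> #|class p U i| = m.
Proof.
elim=> [|{}m S {}U IS SU _ IH].
  by apply/eqP; rewrite cards_eq0; apply/eqP/setP => v; rewrite !inE.
by rewrite card_class_disjU // IH (card_class_IT i IS) inE.
Qed.

Lemma card_preim_classes (T K : finType) (p : T -> K) (U : {set T}) (B : {set K}) :
  #|[set v in U | p v \in B]| = \sum_(i in B) #|class p U i|.
Proof.
rewrite -sum1_card (partition_big p (mem B)) /=; last by move=> v; rewrite inE => /andP[].
apply: eq_bigr => i iB; rewrite -sum1_card; apply: eq_bigl => v.
by rewrite !inE; case: eqP => [->|]; rewrite ?iB ?andbT ?andbF.
Qed.

(* Deleting the neighbours of y costs at most D vertices in total, so weighted_IT
   still applies to the other classes with n1 - D in place of n1. *)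
Lemma undominated_row (T K X : finType) (e : rel T) (p : T -> K) (U : {set T})
    (D n1 q : nat) (y : T) (P : X -> nat) (g : X -> T) :
  symmetric e -> irreflexive e -> 0 < n1 -> (4 * q + 1) * D <= 2 * q * n1 ->
  (forall v, #|nbr e v| <= D) -> (forall i, n1 <= #|class p U i|) ->
  exists2 S, is_IT e p (U :\: nbr e y) [set~ p y] S &
    \sum_x P x <= (2 * q + 1) * \sum_(x | [forall s in S, ~~ e (g x) s]) P x.
Proof.
move=> esym eirr n10 Dn1 degD sizeU.
have D2n1 : 2 * D < n1 by nia.
pose U' := U :\: nbr e y.
(* The cost of [u] is the weight of the indices it spoils. Hence the cost of [S] bounds the spoiled
   weight by [D / (n1 - D)] of the total, and [D <= 2 * q * (n1 - 2 * D)] turns this into at most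
   [2 * q] times the unspoiled weight. *)
pose c u := \sum_x P x * e (g x) u.
have [||B B0 BI|S IS cS] := @weighted_IT T K e p U' [set~ p y] D (n1 - D) c esym eirr.
- by lia.
- by move=> v _; apply: leq_trans (degD v); apply: subset_leq_card (subsetIl _ _).
- have B1 : 0 < #|B| by rewrite card_gt0.
  have : #|B| * n1 <= #|[set v in U | p v \in B]|.
    by rewrite card_preim_classes -sum_nat_const; apply: leq_sum => i _.
  have : #|[set v in U | p v \in B]| <= #|[set v in U' | p v \in B]| + #|nbr e y|.
    apply: leq_trans (leq_card_setU _ _); apply: subset_leq_card.
    by apply/subsetP => v; rewrite !inE => /andP[-> ->]; case: (e y v).
  have := degD y; case: #|B| B1 => // b _ /=; nia.
exists S => //; set und := \sum_(x | [forall s in S, _]) _.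
pose dom := \sum_(x | ~~ [forall s in S, ~~ e (g x) s]) P x.
have tot : \sum_x P x = und + dom.
  by rewrite (bigID (fun x => [forall s in S, ~~ e (g x) s])).
have domc : dom <= \sum_(u in S) c u.
  rewrite /c exchange_big /dom big_mkcond /=; apply: leq_sum => x _.
  case: ifP => // /forallPn[s]; rewrite negb_imply negbK => /andP[sS egs].
  by rewrite (bigD1 s) //= egs muln1 leq_addr.
have cU : \sum_(u in U') c u <= D * \sum_x P x.
  rewrite /c exchange_big big_distrr /=; apply: leq_sum => x _.
  rewrite -big_distrr /= [leqLHS]mulnC leq_mul2r; apply/orP; right.
  apply: leq_trans (degD (g x)); rewrite -sum1_card [leqRHS]big_mkcond.
  rewrite [leqLHS]big_mkcond /=; apply: leq_sum => u _; rewrite [in leqRHS]inE.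
  by case: (u \in U'); case: (e (g x) u).
rewrite tot; rewrite tot in cU.
have : (n1 - D) * dom <= D * (und + dom).
  by apply: leq_trans cU; apply: leq_trans cS; rewrite leq_mul2l domc orbT.
rewrite mulnBl => h.
have : (n1 - 2 * D) * dom <= D * und by rewrite mulnBl; nia.
have : D <= 2 * q * (n1 - 2 * D) by nia.
move=> h1 h2; have : (n1 - 2 * D) * dom <= (n1 - 2 * D) * (2 * q * und) by nia.
rewrite leq_mul2l => /orP[|]; lia.
Qed.

Lemma imset_cons (K T : finType) (x : K -> T) (i : K) (s : seq K) :
  [set x j | j in i :: s] = x i |: [set x j | j in s].
Proof.
apply/setP => v; rewrite in_setU1; apply/imsetP/orP => [[j]|].
  rewrite inE => /orP[/eqP->|js] ->; first by left.
  by right; apply: imset_f.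
case=> [/eqP->|/imsetP[j js ->]]; first by exists i; rewrite ?inE ?eqxx.
by exists j; rewrite // inE js orbT.
Qed.

(** The rows [S i] are built one class at a time, [B] being their union. Row [i] misses only class
    [i] and can be completed by [y i] or by any [x i] with no neighbour in it. The packing claim is
    uniform in [x], so one [B] serves both [y] and every compatible [x]. *)
Lemma absorber_rows (T K : finType) (e : rel T) (p : T -> K) (U : {set T})
    (D n1 q : nat) (P : {ffun K -> T} -> nat) (y : K -> T) (s : seq K) :
  symmetric e -> irreflexive e -> 0 < n1 -> (4 * q + 1) * D <= 2 * q * n1 ->
  (forall v, #|nbr e v| <= D) -> (forall i, n1 + #|K| <= #|class p U i|) ->
  (forall i, p (y i) = i) -> uniq s ->
  exists S : K -> {set T}, exists B : {set T},
  [/\ B \subset U, forall i, y i \notin B,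
      forall i, i \in s -> forall v, v \in S i -> ~~ e (y i) v,
      forall x : K -> T, (forall i, i \in s -> [/\ p (x i) = i, x i \notin B &
          forall v, v \in S i -> ~~ e (x i) v]) ->
        packing e p (size s) (B :|: [set x i | i in s])
    & \sum_x P x <= (2 * q + 1) ^ size s *
        \sum_(x : {ffun K -> T} | all (fun i => [forall v in S i, ~~ e (x i) v]) s) P x].
Proof.
move=> esym eirr n10 Dn1 degD sizeU py.
elim: s => [_|i s IHs /= /andP[is_ us]].
  exists (fun=> set0), set0; split.
  - exact: sub0set.
  - by move=> i; rewrite inE.
  - by [].
  - move=> x _; rewrite set0U (_ : [set x i | i in _] = set0); first exact: packing0.
    by apply/setP => v; rewrite inE; apply/imsetP => -[].
  - by rewrite expn0 mul1n.
have [S [B [BU yB yS packB sumP]]] := IHs us.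
have sK : size s < #|K|.
  by have := @max_card _ (mem (i :: s)); rewrite (card_uniqP _) //= is_ us.
pose Y := [set y j | j in K].
have packY : packing e p (size s) (B :|: [set y j | j in s]).
  by apply: packB => j js; split=> //; apply: yS.
pose U' := U :\: (Y :|: B).
(* [Y] takes one vertex of each class and [B] at most [size s], together at most [#|K|]. *)
have sizeU' j : n1 <= #|class p U' j|.
  have := card_classD p U (Y :|: B) j; have := sizeU j.
  have := card_classU p Y B j; rewrite -/U'.
  have : #|class p Y j| <= 1.
    apply: (@leq_trans #|[set y j]|); last by rewrite cards1.
    apply: subset_leq_card; apply/subsetP => v; rewrite !inE.
    by case/andP => /imsetP[l _ ->]; rewrite py => /eqP->.
  have : #|class p B j| <= size s.
    rewrite -(card_class_packing j packY); apply: subset_leq_card.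
    by apply/subsetP => v; rewrite !inE => /andP[-> ->].
  by lia.
(* Weighting the new row by [good x * P x] makes the losses multiply, by a factor [2 * q + 1] per
   row. *)
pose good x := all (fun i => [forall v in S i, ~~ e (x i) v]) s.
have [R IR sumR] := undominated_row (y i) (fun x : {ffun K -> T} => good x * P x)
  (fun x => x i) esym eirr n10 Dn1 degD sizeU'.
case/is_ITP: (IR) => RU Rind Rinj Rim.
have RU' v : v \in R -> [/\ v \in U, v \notin Y, v \notin B & ~~ e (y i) v].
  move/(subsetP RU); rewrite !in_setD in_setU negb_or => /and3P[h /andP[? ?] ?].
  by split=> //; move: h; rewrite inE.
have pR v : v \in R -> p v != i.
  move=> vR; have: p v \in p @: R by exact: imset_f.
  by rewrite Rim !inE py.
pose S' j := if j == i then R else S j.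
have S's j : j \in s -> S' j = S j.
  by rewrite /S'; case: eqP => // -> h; rewrite h in is_.
have S'i : S' i = R by rewrite /S' eqxx.
exists S', (R :|: B); split.
- by rewrite subUset BU andbT; apply/subsetP => v /RU'[].
- move=> j; rewrite inE negb_or yB andbT; apply/negP => /RU'[_ /negP h _ _].
  by apply: h; apply: imset_f.
- move=> j; rewrite inE => /orP[/eqP->|js]; first by rewrite S'i => v /RU'[].
  by rewrite S's //; apply: yS.
- move=> x hx.
  have [pxi xiRB xiR] := hx i (mem_head _ _); rewrite S'i in xiR.
  have hs j : j \in s -> [/\ p (x j) = j, x j \notin R :|: B & forall v, v \in S j -> ~~ e (x j) v].
    by move=> js; rewrite -S's //; apply: hx; rewrite inE js orbT.
  rewrite imset_cons.
  have -> : R :|: B :|: (x i |: [set x j | j in s]) = (x i |: R) :|: (B :|: [set x j | j in s]).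
    by rewrite setUACA (setUC R).
  have packx : packing e p (size s) (B :|: [set x j | j in s]).
    by apply: packB => j /hs[? + ?]; rewrite inE negb_or => /andP[_ ?].
  apply: (packingS _ _ packx).
    apply/is_ITP; split.
    + exact: subsetT.
    + move=> u w; rewrite !inE => /orP[/eqP->|uR] /orP[/eqP->|wR].
      * by rewrite eirr.
      * exact: xiR.
      * by rewrite esym xiR.
      * exact: Rind.
    + move=> u w; rewrite !inE => /orP[/eqP->|uR] /orP[/eqP->|wR] // E.
      * by move: (pR w wR); rewrite -E pxi eqxx.
      * by move: (pR u uR); rewrite E pxi eqxx.
      * exact: Rinj.
    + by rewrite imsetU1 Rim pxi py setUCr.
  rewrite disjoint_subset; apply/subsetP => v; rewrite in_setU1 inE in_setU negb_or.
  case/orP => [/eqP->|vR].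
    move: xiRB; rewrite inE negb_or => /andP[_ -> /=].
    apply/imsetP => -[j js E]; have [pxj _ _] := hs j js.
    by move: is_; rewrite -pxi E pxj js.
  have [_ _ -> _] := RU' v vR; apply/imsetP => -[j js E].
  by have [_ + _] := hs j js; rewrite -E inE vR.
- rewrite expnSr -mulnA; apply: leq_trans sumP _; rewrite leq_mul2l; apply/orP; right.
  have -> : \sum_(x : {ffun K -> T} | good x) P x = \sum_(x : {ffun K -> T}) good x * P x.
    by rewrite big_mkcond; apply: eq_bigr => x _; case: (good x); rewrite ?mul1n.
  apply: leq_trans sumR _; rewrite leq_mul2l; apply/orP; right.
  rewrite [leqLHS]big_mkcond [leqRHS]big_mkcond /=; apply: leq_sum => x _; rewrite S'i.
  have -> : all (fun j => [forall v in S' j, ~~ e (x j) v]) s = good x.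
    by apply: eq_in_all => j js; rewrite S's.
  by case: [forall _ in _, _] => //=; case: (good x); rewrite ?mul1n.
Qed.

(** [a.1] is the vertex set and [a.2] the set of transversals it can absorb. A transversal is a
    choice function here, whose values may be adjacent, so arbitrary leftovers can be treated. *)
Definition absorber (T K : finType) (e : rel T) (p : T -> K)
    (a : {set T} * {set {ffun K -> T}}) : Prop :=
  packing e p #|K| a.1 /\
  forall x : {ffun K -> T}, x \in a.2 -> (forall i, p (x i) = i) ->
    (forall i, x i \notin a.1) -> packing e p #|K|.+1 (a.1 :|: [set x i | i in K]).

Lemma absorber_step (T K : finType) (e : rel T) (p : T -> K) (U : {set T})
    (D n1 q : nat) (P : {ffun K -> T} -> nat) :
  symmetric e -> irreflexive e -> 0 < n1 -> (4 * q + 1) * D <= 2 * q * n1 ->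
  (forall v, #|nbr e v| <= D) -> (forall i, n1 + #|K| <= #|class p U i|) ->
  exists a, [/\ absorber e p a, a.1 \subset U
    & \sum_x P x <= (2 * q + 1) ^ #|K| * \sum_(x in a.2) P x].
Proof.
move=> esym eirr n10 Dn1 degD sizeU.
(* With cost 0 this is plain existence of an independent transversal [Y]. *)
have [|B B0 BI|Y IY _] := @weighted_IT T K e p U setT D n1 (fun=> 0) esym eirr n10.
- by move=> v _; apply: leq_trans (degD v); apply: subset_leq_card (subsetIl _ _).
- have B1 : 0 < #|B| by rewrite card_gt0.
  have : #|B| * n1 <= #|[set v in U | p v \in B]|.
    rewrite card_preim_classes -sum_nat_const; apply: leq_sum => i _.
    by apply: leq_trans (sizeU i); apply: leq_addr.
  by case: #|B| B1 => // b _ /=; nia.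
case/is_ITP: (IY) => YU Yind Yinj Yim.
have IY' : is_IT e p setT setT Y by apply/is_ITP; rewrite subsetT.
have yex i : exists v, (v \in Y) && (p v == i).
  have: i \in p @: Y by rewrite Yim inE.
  by case/imsetP => v vY ->; exists v; rewrite vY eqxx.
pose y i := xchoose (yex i).
have yY i : y i \in Y by have /andP[] := xchooseP (yex i).
have py i : p (y i) = i by have /andP[_ /eqP] := xchooseP (yex i).
have EY : [set y i | i in K] = Y.
  apply/setP => v; apply/imsetP/idP => [[i _ ->] //|vY].
  by exists (p v) => //; apply: Yinj; rewrite ?py.
have [S [B [BU yB yS packB sumP]]] :=
  absorber_rows P esym eirr n10 Dn1 degD sizeU py (enum_uniq K).
have Eim (x : K -> T) : [set x i | i in enum K] = [set x i | i in K].
  by apply/setP => v; apply/imsetP/imsetP => -[i _ ->]; exists i; rewrite ?mem_enum.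
rewrite -cardE in sumP packB.
have packA : packing e p #|K| (B :|: Y).
  by rewrite -EY -Eim; apply: packB => i ii; split=> //; apply: yS.
exists (B :|: Y, [set x : {ffun K -> T} | all (fun i => [forall v in S i, ~~ e (x i) v]) (enum K)]).
split=> /=; last by rewrite (eq_bigl _ _ (in_set _)).
- split=> // x; rewrite inE /= => /allP xS px xA.
  (* Once each [x i] replaces [y i] in its row, [Y] is released and is the additional independent
     transversal. *)
  rewrite -setUA setUC -setUA (setUC _ B) -addn1 addnC.
  apply: packingU; first exact: packing1.
    rewrite -Eim; apply: packB => i ii; split=> //.
      by move: (xA i); rewrite inE negb_or => /andP[].
    by move=> v vS; have /forall_inP := xS i ii; apply.
  rewrite disjoint_subset; apply/subsetP => v vY; rewrite inE in_setU negb_or.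
  apply/andP; split; first by rewrite -EY in vY; case/imsetP: vY => i _ ->.
  by apply/imsetP => -[i _ E]; move: (xA i); rewrite inE -E vY orbT.
- by rewrite subUset BU.
Qed.

(** * Families of disjoint absorbers *)

Definition cover_seq (T X : finType) (As : seq ({set T} * {set X})) : {set T} :=
  \bigcup_(a <- As) a.1.

(** Phrased by counting, disjointness is invariant under permuting the list, as needed when a used
    absorber is moved to the front and removed. *)
Definition disjoint_seq (T X : finType) (As : seq ({set T} * {set X})) : Prop :=
  forall v, count (fun a : {set T} * {set X} => v \in a.1) As <= 1.

Lemma in_cover_seq (T X : finType) (As : seq ({set T} * {set X})) (v : T) :
  (v \in cover_seq As) = has (fun a : {set T} * {set X} => v \in a.1) As.
Proof.
by elim: As => [|a As IH]; rewrite /cover_seq ?big_nil ?big_cons /= !inE // IH.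
Qed.

Lemma disjoint_seq_cons (T X : finType) (a : {set T} * {set X}) (As : seq ({set T} * {set X})) :
  disjoint_seq (a :: As) -> disjoint_seq As /\ [disjoint a.1 & cover_seq As].
Proof.
move=> dAs; split=> [v|]; first by have /= := dAs v; lia.
rewrite disjoint_subset; apply/subsetP => v va; rewrite inE in_cover_seq has_count.
by have /= := dAs v; rewrite va; lia.
Qed.

Lemma cover_packing (T K : finType) (e : rel T) (p : T -> K) As :
  (forall a, a \in As -> absorber e p a) -> disjoint_seq As ->
  packing e p (#|K| * size As) (cover_seq As).
Proof.
elim: As => [_ _|a As IH absA /disjoint_seq_cons[dAs daAs]].
  by rewrite muln0 /cover_seq big_nil; apply: packing0.
rewrite /cover_seq big_cons /= mulnS; apply: packingU => //.
  by have [] := absA a (mem_head _ _).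
by apply: IH => // b bAs; apply: absA; rewrite inE bAs orbT.
Qed.

(** The integer form of [(1 - 1/j)^j <= 1/2], from Bernoulli's inequality. *)
Lemma expn_pred_double (j : nat) : 0 < j -> 2 * j.-1 ^ j <= j ^ j.
Proof.
case: j => // j _ /=.
have bern m : j ^ m + m * j ^ m.-1 <= j.+1 ^ m.
  elim: m => // -[|m] IH; first by rewrite /= !expn1 expn0; lia.
  rewrite [j.+1 ^ _]expnS; apply: leq_trans (leq_mul (leqnn _) IH) => /=.
  by rewrite !expnS; nia.
by have := bern j.+1; rewrite /= expnS; nia.
Qed.

(** Derandomized choice: weighting [x] by 2 to the minus number of hits, each new absorber catches
    at least a fraction [1/Q] of the weight, with [Q = (2 * q + 1) ^ #|K|], and halves it there. The
    weight shrinks by [1 - 1/(2Q)] per step; the factor [2 ^ M] keeps everything integral. *)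
Lemma absorber_family (T K : finType) (e : rel T) (p : T -> K) (D n1 q M : nat) :
  symmetric e -> irreflexive e -> 0 < n1 -> (4 * q + 1) * D <= 2 * q * n1 ->
  (forall v, #|nbr e v| <= D) ->
  (forall i, n1 + #|K| * M <= #|class p setT i|) ->
  exists As : seq ({set T} * {set {ffun K -> T}}),
  [/\ size As = M, forall a, a \in As -> absorber e p a, disjoint_seq As
    & ((2 * q + 1) ^ #|K|) ^ M * \sum_x 2 ^ (M - count (fun a : {set T} * {set {ffun K -> T}} => x \in a.2) As)
        <= (2 * (2 * q + 1) ^ #|K|).-1 ^ M * #|{ffun K -> T}|].
Proof.
move=> esym eirr n10 Dn1 degD; set Q := (2 * q + 1) ^ #|K|.
have Q0 : 0 < Q by rewrite expn_gt0 addn1.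
elim: M => [_|M IH sizeT].
  by exists [::]; split; rewrite // !mul1n sum1_card.
have [i|As [sAs absAs dAs potAs]] := IH.
  by apply: leq_trans (sizeT i); rewrite leq_add2l leq_mul2l leqnSn orbT.
pose cnt x := count (fun a : {set T} * {set {ffun K -> T}} => x \in a.2) As.
have cntM x : cnt x <= M by rewrite -sAs; apply: count_size.
have packAs := cover_packing absAs dAs.
have sizeU i : n1 + #|K| <= #|class p (~: cover_seq As) i|.
  have := sizeT i; have := card_class_disjU p i (_ : [disjoint ~: cover_seq As & cover_seq As]).
  rewrite setUC setUCr (card_class_packing i packAs) sAs => -> //.
    by rewrite mulnS; lia.
  by rewrite disjoints_subset subxx.
have [a [absa aU sumP]] := absorber_step (fun x => 2 ^ (M - cnt x)) esym eirr n10 Dn1 degD sizeU.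
exists (a :: As); split=> //=.
- by rewrite sAs.
- by move=> b; rewrite inE => /orP[/eqP->|/absAs].
- move=> v /=; case: (boolP (v \in a.1)) => [va|_]; last exact: dAs.
  have : v \notin cover_seq As by move/subsetP: aU => /(_ v va); rewrite inE.
  by rewrite in_cover_seq has_count; lia.
rewrite -/Q in sumP *.
have E : \sum_x 2 ^ (M.+1 - ((x \in a.2) + cnt x)) + \sum_(x in a.2) 2 ^ (M - cnt x) =
    2 * \sum_x 2 ^ (M - cnt x).
  rewrite [X in _ + X]big_mkcond -big_split big_distrr /=; apply: eq_bigr => x _.
  case: (x \in a.2); first by rewrite add1n subSS mul2n addnn.
  by rewrite add0n addn0 subSn // expnS.
rewrite -/cnt; set A := \sum_x _ in E *; set B := \sum_(x in _) _ in E sumP.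
set C := \sum_x _ in E sumP potAs.
have h : Q * A <= (2 * Q).-1 * C.
  have : Q * A + Q * B = 2 * Q * C by rewrite -mulnDr E mulnCA mulnA.
  by rewrite -subn1 mulnBl mul1n; lia.
rewrite !expnS -[leqLHS]mulnA mulnCA.
apply: (@leq_trans (Q ^ M * ((2 * Q).-1 * C))); first by rewrite leq_mul2l h orbT.
by rewrite mulnCA -[leqRHS]mulnA leq_mul2l potAs orbT.
Qed.

(** With [M = 4Qm] absorbers the weight falls below [#|T| ^ #|K| / 4 ^ m], as
    [(1 - 1/(2Q))^(2Q) <= 1/2]. A single [x] hit fewer than [m] times would contribute more than
    [2 ^ (- m)], against [#|T| ^ #|K| < 2 ^ m]. *)
Lemma absorber_family_hits (T K : finType) (e : rel T) (p : T -> K) (D n1 q m : nat) :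
  symmetric e -> irreflexive e -> 0 < n1 -> (4 * q + 1) * D <= 2 * q * n1 ->
  (forall v, #|nbr e v| <= D) ->
  (forall i, n1 + #|K| * (4 * (2 * q + 1) ^ #|K| * m) <= #|class p setT i|) ->
  #|T| ^ #|K| < 2 ^ m ->
  exists As : seq ({set T} * {set {ffun K -> T}}),
  [/\ size As = 4 * (2 * q + 1) ^ #|K| * m, forall a, a \in As -> absorber e p a,
      disjoint_seq As & forall x, m <= count (fun a : {set T} * {set {ffun K -> T}} => x \in a.2) As].
Proof.
move=> esym eirr n10 Dn1 degD sizeT small.
have [As [sAs absAs dAs pot]] := absorber_family esym eirr n10 Dn1 degD sizeT.
exists As; split=> // x; rewrite leqNgt; apply/negP => few.
move: pot; set Q := (2 * q + 1) ^ #|K| in sAs sizeT *; set M := 4 * Q * m in sAs *.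
have Q0 : 0 < Q by rewrite expn_gt0 addn1.
rewrite card_ffun; apply/negP; rewrite -ltnNge.
have m0 : 0 < m by apply: leq_ltn_trans few.
have mM : m <= M by rewrite /M; nia.
have h1 : 2 ^ (M - m) <= \sum_x 2 ^ (M - count (fun a : {set T} * {set {ffun K -> T}} => x \in a.2) As).
  by rewrite (bigD1 x) //=; apply: leq_trans (leq_addr _ _); rewrite leq_pexp2l // leq_sub2l // ltnW.
have h2 : 4 ^ m * (2 * Q).-1 ^ M <= (2 * Q) ^ M.
  have -> : M = 2 * Q * (2 * m) by rewrite /M; nia.
  rewrite (expnM (2 * Q)) (expnM (2 * Q).-1) (_ : 4 = 2 ^ 2) // -expnM -expnMn.
  by rewrite leq_exp2r ?muln_gt0 ?m0 // expn_pred_double // muln_gt0.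
apply: leq_trans (leq_mul (leqnn (Q ^ M)) h1).
rewrite -(ltn_pmul2l (_ : 0 < 2 ^ m)) ?expn_gt0 // [ltnRHS]mulnCA -expnD subnKC //.
rewrite -expnMn (mulnC Q 2); apply: leq_trans h2.
rewrite (_ : 4 = 2 * 2) // expnMn -mulnA ltn_pmul2l ?expn_gt0 // mulnC ltn_pmul2r //.
by rewrite expn_gt0 (_ : 0 < (2 * Q).-1) //; lia.
Qed.

(** Greedy: one vertex of [L] per class forms [x], and an absorber for [x] is spent on it. This
    lowers every hit count by at most 1, exactly as much as the class sizes of [L]. *)
Lemma absorb_leftover (T K : finType) (e : rel T) (p : T -> K) As (L : {set T}) (l : nat) :
  (forall a, a \in As -> absorber e p a) -> disjoint_seq As ->
  (forall x, l <= count (fun a : {set T} * {set {ffun K -> T}} => x \in a.2) As) ->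
  (forall i, #|class p L i| = l) -> [disjoint L & cover_seq As] ->
  packing e p (#|K| * size As + l) (L :|: cover_seq As).
Proof.
elim: l As L => [|l IH] As L absAs dAs cntAs sizeL dL.
  rewrite addn0 (_ : L = set0) ?set0U; first exact: cover_packing.
  apply/setP => v; rewrite inE; apply/negP => vL.
  by move/eqP: (sizeL (p v)); rewrite cards_eq0 => /eqP/setP/(_ v); rewrite !inE vL eqxx.
have xex i : exists v, v \in class p L i.
  by apply/set0Pn; rewrite -card_gt0 sizeL.
pose x := [ffun i => xchoose (xex i)].
have xP i : x i \in L /\ p (x i) = i.
  by have := xchooseP (xex i); rewrite /x ffunE inE => /andP[? /eqP].
have : has (fun a : {set T} * {set {ffun K -> T}} => x \in a.2) As by rewrite has_count; apply: leq_trans (cntAs x).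
case/hasP => a aAs xa.
have perma := perm_to_rem aAs; set As' := rem a As in perma.
have cntE (P : pred _) : count P As = P a + count P As'.
  by rewrite (permP perma).
have memAs' b : b \in As' -> b \in As by rewrite (perm_mem perma) inE orbC => ->.
have covE : cover_seq As = a.1 :|: cover_seq As'.
  by apply/setP => v; rewrite inE !in_cover_seq !has_count cntE addn_gt0 lt0b.
have [dAs' daAs'] : disjoint_seq As' /\ [disjoint a.1 & cover_seq As'].
  by apply: disjoint_seq_cons => v; have := dAs v; rewrite cntE.
have [_ absa] := absAs a aAs.
have Lnot v : v \in L -> (v \notin a.1) && (v \notin cover_seq As').
  by move=> vL; have := disjointFr dL vL; rewrite covE inE -negb_or => ->.
have packa : packing e p #|K|.+1 (a.1 :|: [set x i | i in K]).
  apply: absa => // i; first by have [] := xP i.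
  by have [/Lnot/andP[]] := xP i.
pose X := [set x i | i in K].
have XL : X \subset L by apply/subsetP => v /imsetP[i _ ->]; have [] := xP i.
have classX i : class p X i = [set x i].
  apply/setP => v; rewrite !inE; apply/andP/eqP => [[/imsetP[j _ ->]]|->].
    by have [_ ->] := xP j => /eqP->.
  by have [_ ->] := xP i; rewrite eqxx; split=> //; apply: imset_f.
have EL : X :|: (L :\: X) = L.
  by apply/setP => v; rewrite in_setU in_setD; case: (boolP (v \in X)) => // /(subsetP XL) ->.
have sizeL' i : #|class p (L :\: X) i| = l.
  have dX : [disjoint X & L :\: X] by rewrite disjoint_sym disjoints_subset subsetDr.
  have := card_class_disjU p i dX; rewrite EL sizeL classX cards1; lia.
have := IH As' (L :\: X) _ dAs' _ sizeL' _.
move=> /(_ (fun b bAs' => absAs b (memAs' b bAs'))).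
have h1 y : l <= count (fun a : {set T} * {set {ffun K -> T}} => y \in a.2) As'.
  by have := cntAs y; rewrite cntE /=; case: (y \in a.2); lia.
move=> /(_ h1).
have h2 : [disjoint L :\: X & cover_seq As'].
  rewrite disjoint_subset; apply/subsetP => v; rewrite inE => /andP[_ /Lnot/andP[_]].
  by rewrite inE.
move=> /(_ h2) packL.
have sz : #|K| * size As + l.+1 = #|K|.+1 + (#|K| * size As' + l).
  by rewrite (perm_size perma) /= mulnS; lia.
have -> : L :|: cover_seq As = (a.1 :|: X) :|: (L :\: X :|: cover_seq As').
  rewrite covE; apply/setP => v; rewrite !inE; have /implyP := subsetP XL v.
  by case: (v \in X); case: (v \in L); case: (v \in a.1).
rewrite sz; apply: packingU => //.
rewrite disjoint_subset; apply/subsetP => v vaX; rewrite inE in_setU in_setD negb_or.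
move: vaX; rewrite in_setU => /orP[va|vX].
  rewrite (disjointFr daAs' va) andbT negb_and; apply/orP; right.
  by apply/negP => /Lnot; rewrite va.
by rewrite vX /=; have /andP[] := Lnot v (subsetP XL v vX).
Qed.

(** * Packing almost all vertices *)

Import Order.TTheory GRing.Theory Num.Theory.
Local Open Scope ring_scope.

(** Second-order bound, also for negative [z]. The induction step leaves the surplus
    [z ^+ 2 * (3N + 2 - 2N * Nz)], nonnegative because [Nz <= 1/2]. *)
Lemma exp1D_le (F : realFieldType) (z : F) (N : nat) :
  -1 <= z -> N%:R * z <= 1 / 2 ->
  (1 + z) ^+ N <= 1 + N%:R * z + 2 * (N%:R * z) ^+ 2.
Proof.
move=> z1; elim: N => [_|N IH zN]; first by rewrite expr0 !mul0r expr0n /= mulr0 !addr0.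
have N0 : 0 <= N%:R :> F by apply: ler0n.
rewrite -natr1 in zN *.
have zN' : N%:R * z <= 1 / 2 by nra.
rewrite exprS; apply: (@le_trans _ _ ((1 + z) * (1 + N%:R * z + 2 * (N%:R * z) ^+ 2))).
  by apply: ler_wpM2l; [lra | apply: IH].
rewrite -subr_ge0.
have -> : 1 + (N%:R + 1) * z + 2 * ((N%:R + 1) * z) ^+ 2 -
    (1 + z) * (1 + N%:R * z + 2 * (N%:R * z) ^+ 2) =
    z ^+ 2 * (3 * N%:R + 2 - 2 * N%:R * (N%:R * z)) by ring.
by apply: mulr_ge0; [exact: sqr_ge0 | nra].
Qed.

(** A smooth substitute for the maximum of the ratios degree over class size: a value of at most
    [(3 / 2) ^+ N] forces every ratio to be at most 1/2. *)
Definition potential (T : finType) (e : rel T) (U : {set T}) (n N : nat) : rat :=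
  \sum_v (1 + #|nbr e v :&: U|%:R / n%:R) ^+ N.

Lemma card_IT (T K : finType) (e : rel T) (p : T -> K) (Z S : {set T}) :
  is_IT e p Z setT S -> #|S| = #|K|.
Proof. by case/is_ITP => _ _ inj im; rewrite -(card_in_imset inj) im cardsT. Qed.

Lemma card_classes (T K : finType) (p : T -> K) (U : {set T}) (n : nat) :
  (forall i, #|class p U i| = n) -> #|U| = (#|K| * n)%N.
Proof.
move=> sz; have -> : U = [set v in U | p v \in [set: K]].
  by apply/setP => v; rewrite !inE andbT.
rewrite card_preim_classes (eq_bigr (fun=> n)) //.
by rewrite sum_nat_const cardsT.
Qed.

(* The cost W - \sum_v f v * [e v u] turns the upper bound of weighted_IT
   into a lower bound on the weighted number of neighbours hit. *)
Lemma IT_hits_average (T K : finType) (e : rel T) (p : T -> K) (U : {set T})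
    (n : nat) (f : T -> nat) :
  symmetric e -> irreflexive e -> (0 < n)%N ->
  (forall i, #|class p U i| = n) ->
  (forall v, v \in U -> 2 * #|nbr e v :&: U| <= n)%N ->
  exists2 S, is_IT e p U setT S &
    (\sum_v f v * #|nbr e v :&: U| <= n * \sum_v f v * #|nbr e v :&: S|)%N.
Proof.
move=> esym eirr n0 sizeU degU; pose W := (\sum_v f v)%N.
pose w u := (\sum_v f v * e v u)%N.
have wW u : (w u <= W)%N by apply: leq_sum => v _; case: (e v u); rewrite ?muln1 ?muln0.
have sumw (X : {set T}) : (\sum_(u in X) w u = \sum_v f v * #|nbr e v :&: X|)%N.
  rewrite /w exchange_big; apply: eq_bigr => v _; rewrite -big_distrr /=; congr (_ * _)%N.
  rewrite -sum1_card [RHS]big_mkcond [LHS]big_mkcond /=; apply: eq_bigr => u _.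
  by rewrite !inE; case: (e v u); case: (u \in X).
have sumc (X : {set T}) : (\sum_(u in X) (W - w u) + \sum_(u in X) w u = #|X| * W)%N.
  by rewrite -big_split /= (eq_bigr (fun=> W)) ?sum_nat_const // => u _; rewrite subnK.
have [||S IS cS] := @weighted_IT T K e p U setT n./2 n (fun u => W - w u)%N esym eirr n0.
- by move=> v vU; have := degU v vU; lia.
- move=> B B0 _; rewrite card_preim_classes (eq_bigr (fun=> n)) // sum_nat_const.
  by have : (0 < #|B|)%N by [rewrite card_gt0]; case: #|B| => // b _ /=; nia.
exists S => //; rewrite -!sumw.
have := sumc U; have := sumc S; rewrite (card_IT IS) (card_classes sizeU).
move: cS; set a := (\sum_(v in S) _)%N; set b := (\sum_(v in U) _)%N.
set c := (\sum_(v in S) w v)%N; set d := (\sum_(v in U) w v)%N.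
by move: #|K| => k; clear; nia.
Qed.

(** Removing [S] moves each ratio [d/n] by [(d - n * h) / (n * (n - 1))], where [h] counts the
    neighbours in [S]. Averaging makes the total first-order change nonpositive; only a second-order
    error remains. *)
Lemma potential_step (T K : finType) (e : rel T) (p : T -> K) (U : {set T})
    (n m N : nat) :
  symmetric e -> irreflexive e -> (0 < m)%N -> (m < n)%N -> (0 < N)%N ->
  (2 * #|K| * N <= m)%N ->
  (forall i, #|class p U i| = n) ->
  (forall v, v \in U -> 2 * #|nbr e v :&: U| <= n)%N ->
  exists2 S, is_IT e p U setT S &
    potential e (U :\: S) n.-1 N <=
      (1 + 2 * ((#|K| * N)%:R / m%:R) ^+ 2) * potential e U n N.
Proof.
move=> esym eirr m0 mn N0 kNm sizeU degU.
have n0 : (0 < n)%N by apply: leq_trans mn.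
pose d v := #|nbr e v :&: U|.
(* These weights are the derivatives of the summands of the potential, up to a common factor that
   makes them integers. *)
have [S IS hS] := IT_hits_average (fun v => (n + d v) ^ N.-1)%N esym eirr n0 sizeU degU.
exists S => //; case/is_ITP: (IS) => SU _ _ _.
pose h v := #|nbr e v :&: S|.
have dh v : #|nbr e v :&: (U :\: S)| = (d v - h v)%N.
  rewrite setIDA cardsD /d /h; congr (_ - _)%N; apply: eq_card => u.
  by rewrite !inE; case: (boolP (u \in S)) => [/(subsetP SU)->|_]; rewrite ?andbF ?andbT.
have hd v : (h v <= d v)%N by apply/subset_leq_card/setIS.
have hk v : (h v <= #|K|)%N by rewrite -(card_IT IS); apply/subset_leq_card/subsetIr.
have dk v : (d v <= #|K| * n)%N by rewrite -(card_classes sizeU); apply/subset_leq_card/subsetIr.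
set a := 2 * _; pose y v : rat := (d v)%:R / n%:R.
pose D v : rat := ((d v)%:R - n%:R * (h v)%:R) / (n%:R * n.-1%:R).
have nR : 0 < n%:R :> rat by rewrite ltr0n.
have mR : 0 < m%:R :> rat by rewrite ltr0n.
have n1R : m%:R <= n.-1%:R :> rat by rewrite ler_nat; lia.
have n1n : n.-1%:R + 1 = n%:R :> rat by rewrite natr1 prednK.
have y0 v : 0 <= y v by rewrite divr_ge0 ?ler0n.
have yE v : #|nbr e v :&: (U :\: S)|%:R / n.-1%:R = y v + D v.
  rewrite dh natrB // /y /D -n1n; field.
  by rewrite n1n !gt_eqF //; apply: lt_le_trans n1R.
have Dk v : `|D v| <= #|K|%:R / m%:R.
  have n10 : 0 < n.-1%:R :> rat by apply: lt_le_trans n1R.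
  have dR : (d v)%:R <= #|K|%:R * n%:R :> rat by rewrite -natrM ler_nat.
  have hR : (h v)%:R <= #|K|%:R :> rat by rewrite ler_nat.
  have dR0 : 0 <= (d v)%:R :> rat by [].
  have hR0 : 0 <= (h v)%:R :> rat by [].
  rewrite /D normrM normfV (gtr0_norm (_ : 0 < _ * _)) ?mulr_gt0 // ler_pdivrMr ?mulr_gt0 //.
  apply: (@le_trans _ _ (#|K|%:R * n%:R)); first by rewrite ler_norml; nra.
  rewrite mulrAC mulrA ler_pdivlMr // -mulrA.
  rewrite -subr_ge0.
  have -> : #|K|%:R * (n%:R * n.-1%:R) - #|K|%:R * n%:R * m%:R = #|K|%:R * n%:R * (n.-1%:R - m%:R) :> rat by ring.
  by rewrite !mulr_ge0 ?ler0n // subr_ge0.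
have NkR : N%:R * (#|K|%:R / m%:R) <= 1 / 2 :> rat.
  by rewrite mulrA ler_pdivrMr // -natrM; have : (2 * #|K| * N)%:R <= m%:R :> rat by [rewrite ler_nat]; rewrite !natrM; lra.
have step v : (1 + (y v + D v)) ^+ N <= (1 + a) * (1 + y v) ^+ N + N%:R * ((1 + y v) ^+ N.-1 * D v).
  have y1 : 0 < 1 + y v by have := y0 v; lra.
  (* Factoring out [1 + y v] brings the summand to the form of [exp1D_le]. *)
  pose z := D v / (1 + y v).
  have zD : `|z| <= `|D v|.
    rewrite normrM normfV (gtr0_norm y1) ler_pdivrMr // ler_peMr //; have := y0 v; lra.
  have Nz : N%:R * `|z| <= 1 / 2.
    apply: le_trans NkR; apply: ler_wpM2l; first exact: ler0n.
    exact: le_trans (Dk v).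
  have N1 : 1 <= N%:R :> rat by rewrite ler1n.
  have z0 : 0 <= `|z| by [].
  have zle : - `|z| <= z <= `|z| by rewrite -ler_norml.
  have -> : 1 + (y v + D v) = (1 + y v) * (1 + z) by rewrite /z; field; rewrite gt_eqF.
  rewrite exprMn.
  have -> : (1 + y v) ^+ N.-1 * D v = (1 + y v) ^+ N * z.
    by rewrite -[in RHS](prednK N0) exprS /z; field; rewrite gt_eqF.
  apply: (@le_trans _ _ ((1 + y v) ^+ N * (1 + N%:R * z + 2 * (N%:R * z) ^+ 2))).
    apply: ler_wpM2l; first by rewrite exprn_ge0 // ltW.
    apply: exp1D_le; first by case/andP: zle => *; nra.
    by apply: le_trans Nz; apply: ler_wpM2l; [exact: ler0n | case/andP: zle].
  have -> : (1 + a) * (1 + y v) ^+ N + N%:R * ((1 + y v) ^+ N * z) =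
     (1 + y v) ^+ N * (1 + N%:R * z + a) by ring.
  apply: ler_wpM2l; first by rewrite exprn_ge0 // ltW.
  rewrite lerD2l /a ler_wpM2l // natrM mulrAC; set X := N%:R * z; set B := _ * N%:R.
  have /andP[X1 X2] : - B <= X <= B.
    rewrite -ler_norml /X normrM ger0_norm ?ler0n // /B mulrC; apply: ler_wpM2r; first exact: ler0n.
    exact: le_trans (Dk v).
  rewrite -subr_ge0 (_ : _ - _ = (B - X) * (B + X)); last by ring.
  by apply: mulr_ge0; lra.
rewrite /potential; under eq_bigr => v _ do rewrite yE.
apply: (@le_trans _ _ (\sum_v ((1 + a) * (1 + y v) ^+ N + N%:R * ((1 + y v) ^+ N.-1 * D v)))).
  by apply: ler_sum => v _.
rewrite big_split /= -big_distrr /= gerDl -big_distrr /=.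
apply: mulr_ge0_le0; first exact: ler0n.
have n10 : 0 < n.-1%:R :> rat by apply: lt_le_trans n1R.
pose C : rat := (n%:R ^+ N.-1 * (n%:R * n.-1%:R))^-1.
have -> : \sum_v (1 + y v) ^+ N.-1 * D v =
    C * ((\sum_v (n + d v) ^ N.-1 * d v)%:R - (n * \sum_v (n + d v) ^ N.-1 * h v)%:R).
  rewrite natrM !natr_sum [n%:R * _]big_distrr -sumrB big_distrr /=; apply: eq_bigr => v _.
  rewrite !natrM natrX natrD (_ : n%:R + (d v)%:R = n%:R * (1 + y v)); last first.
    by rewrite /y; field; rewrite gt_eqF.
  rewrite exprMn /D /C; field; rewrite !gt_eqF // exprn_gt0 //.
apply: mulr_ge0_le0; last by rewrite subr_le0 ler_nat.
by rewrite invr_ge0 mulr_ge0 ?exprn_ge0 ?mulr_ge0 // ltW.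
Qed.

(** Transversals are removed while classes exceed [m]. The hypothesis keeps the potential, including
    the error accumulated over at most [n] steps, below [(3 / 2) ^+ N], so degrees into what is left
    never exceed half the class size. *)
Lemma near_packing (T K : finType) (e : rel T) (p : T -> K) (U : {set T})
    (D n m N : nat) :
  symmetric e -> irreflexive e -> (0 < m)%N -> (m <= n)%N -> (0 < N)%N ->
  (2 * #|K| * N <= m)%N ->
  (forall v, #|nbr e v| <= D)%N ->
  (forall i, #|class p U i| = n) ->
  #|T|%:R * (1 + 2 * ((#|K| * N)%:R / m%:R) ^+ 2) ^+ n * (1 + D%:R / n%:R) ^+ N
    <= (3 / 2) ^+ N :> rat ->
  exists L : {set T}, [/\ L \subset U, forall i, #|class p L i| = m
    & packing e p (n - m) (U :\: L)].
Proof.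
move=> esym eirr m0 mn N0 kNm degD sizeU small.
set a := 1 + _ in small.
have a1 : 1 <= a by rewrite /a lerDl mulr_ge0 // sqr_ge0.
have nR : 0 < n%:R :> rat by rewrite ltr0n; apply: leq_trans mn.
suff main j : (j <= n - m)%N -> exists L : {set T},
    [/\ L \subset U, forall i, #|class p L i| = (n - j)%N, packing e p j (U :\: L)
      & potential e L (n - j) N <= a ^+ j * potential e U n N].
  by have [L [LU sL pL _]] := main (n - m)%N (leqnn _); exists L; split=> // i; rewrite sL subKn.
elim: j => [_|j IH jnm].
  by exists U; rewrite subn0 expr0 mul1r setDv; split=> //; apply: packing0.
have [L [LU sL pL potL]] := IH (ltnW jnm).
have jn : (m < n - j)%N by lia.
have degL v : v \in L -> (2 * #|nbr e v :&: L| <= n - j)%N.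
  move=> vL; rewrite leqNgt; apply/negP => big.
  have : (1 + #|nbr e v :&: L|%:R / (n - j)%:R) ^+ N <= (3 / 2) ^+ N :> rat.
    apply: le_trans small; apply: (@le_trans _ _ (potential e L (n - j) N)).
      rewrite /potential (bigD1 v) //= lerDl; apply: sumr_ge0 => u _.
      by rewrite exprn_ge0 // addr_ge0 // divr_ge0 ?ler0n.
    apply: le_trans potL _.
    have potU : potential e U n N <= #|T|%:R * (1 + D%:R / n%:R) ^+ N.
      rewrite /potential -sum1_card natr_sum big_distrl /=; apply: ler_sum => u _; rewrite mul1r.
      apply: lerXn2r; rewrite ?nnegrE ?addr_ge0 ?divr_ge0 ?ler0n //.
      rewrite lerD2l ler_pM2r ?invr_gt0 // ler_nat; apply: leq_trans (degD u).
      exact/subset_leq_card/subsetIl.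
    rewrite mulrAC mulrC; apply: ler_pM => //.
    + by apply: sumr_ge0 => u _; rewrite exprn_ge0 // addr_ge0 // divr_ge0 ?ler0n.
    + by rewrite exprn_ge0 // (le_trans ler01).
    + by rewrite ler_weXn2l // (leq_trans (ltnW jnm)) // leq_subr.
  have n'R : 0 < (n - j)%:R :> rat by rewrite ltr0n; lia.
  rewrite ler_pXn2r ?nnegrE ?addr_ge0 ?divr_ge0 ?ler0n // => h.
  have : #|nbr e v :&: L|%:R / (n - j)%:R <= 1 / 2 :> rat by lra.
  rewrite ler_pdivrMr //; have : (n - j)%:R < (2 * #|nbr e v :&: L|)%:R :> rat by rewrite ltr_nat.
  by rewrite natrM; lra.
have [S IS potS] := potential_step esym eirr m0 jn N0 kNm sL degL.
case/is_ITP: (IS) => SL Sind Sinj Sim.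
have IS' : is_IT e p setT setT S by apply/is_ITP; rewrite subsetT.
have DSL : [disjoint L :\: S & S] by rewrite disjoints_subset subsetDr.
have ES : (L :\: S) :|: S = L.
  by apply/setP => v; rewrite in_setU in_setD; case: (boolP (v \in S)) => [/(subsetP SL)->|]; rewrite ?orbF.
exists (L :\: S); split.
- exact: subset_trans (subsetDl _ _) LU.
- move=> i; have := card_class_disjU p i DSL.
  by rewrite ES sL (card_class_IT i IS) inE; lia.
- have -> : U :\: (L :\: S) = S :|: (U :\: L).
    apply/setP => v; rewrite in_setU !in_setD; case: (boolP (v \in S)) => [/(subsetP SL) vL|_].
      by rewrite (subsetP LU).
    by [].
  apply: packingS => //; rewrite disjoint_subset; apply/subsetP => v /(subsetP SL) vL.
  by rewrite inE in_setD vL.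
- rewrite subnS; apply: le_trans potS _; rewrite -/a [a ^+ j.+1]exprS -mulrA; apply: ler_wpM2l => //.
  exact: le_trans a1.
Qed.

(** * Assembly and choice of parameters *)

Lemma packing_partition (T K : finType) (e : rel T) (p : T -> K) (m : nat) (U : {set T}) :
  (0 < #|K|)%N -> packing e p m U ->
  exists2 Q, partition Q U & forall S, S \in Q -> is_IT e p setT setT S.
Proof.
move=> K0; elim=> [|{}m S {}U IS SU _ [Q QU ITQ]].
  by exists set0; [rewrite partition_set0 | move=> S; rewrite inE].
exists (S |: Q); first apply: partitionU1 => //.
  (* Blocks of a partition must be nonempty; this is where at least one class is required. *)
  by apply/negP => /eqP S0; move: K0; rewrite -(card_IT IS) S0 cards0.
by move=> S'; rewrite inE => /orP[/set1P->|/ITQ].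
Qed.

(** Absorbers [W] are set aside first, the rest is packed down to [m] vertices per class, and [W]
    absorbs these, every transversal being hit at least [m] times. *)
Lemma packing_setT (T K : finType) (e : rel T) (p : T -> K) (D r q m N : nat) :
  let M := (4 * (2 * q + 1) ^ #|K| * m)%N in
  let n := (r - #|K| * M)%N in
  symmetric e -> irreflexive e -> (0 < m)%N -> (m <= n)%N -> (0 < N)%N ->
  (2 * #|K| * N <= m)%N -> (#|K| * M <= r)%N ->
  (forall v, #|nbr e v| <= D)%N ->
  (forall i, #|class p setT i| = r) ->
  ((4 * q + 1) * D <= 2 * q * n)%N ->
  (#|T| ^ #|K| < 2 ^ m)%N ->
  #|T|%:R * (1 + 2 * ((#|K| * N)%:R / m%:R) ^+ 2) ^+ n * (1 + D%:R / n%:R) ^+ N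
    <= (3 / 2) ^+ N :> rat ->
  packing e p r setT.
Proof.
move=> M n esym eirr m0 mn N0 kNm kMr degD sizeT Dn small1 small2.
have n0 : (0 < n)%N by apply: leq_trans mn.
have sizeT' i : (n + #|K| * M <= #|class p setT i|)%N by rewrite sizeT subnK.
have [As [sAs absAs dAs hits]] := absorber_family_hits esym eirr n0 Dn degD sizeT' small1.
have packW := cover_packing absAs dAs; rewrite sAs -/M in packW.
set W := cover_seq As in packW *.
have dWC : [disjoint ~: W & W] by rewrite disjoints_subset subxx.
have sizeU i : #|class p (~: W) i| = n.
  have := card_class_disjU p i dWC.
  by rewrite setUC setUCr sizeT (card_class_packing i packW) /n => ->; rewrite addnK.
have [L [LU sizeL packUL]] := near_packing esym eirr m0 mn N0 kNm degD sizeU small2.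
have dLW : [disjoint L & W] by rewrite disjoints_subset.
have := absorb_leftover absAs dAs hits sizeL dLW; rewrite sAs -/M -/W => packLW.
have -> : [set: T] = (~: W :\: L) :|: (L :|: W).
  by apply/setP => v; rewrite !in_setU in_setD in_setC in_setT; case: (v \in L); case: (v \in W).
have -> : r = (n - m + (#|K| * M + m))%N by move: mn; rewrite /n; move: (#|K| * M)%N kMr => X; clear; lia.
apply: packingU => //.
rewrite disjoint_sym disjoints_subset; apply/subsetP => v.
by rewrite in_setU in_setC in_setD in_setC; case: (v \in L); case: (v \in W).
Qed.

Lemma linear_le_exp2 (G j : nat) : (0 < j)%N ->
  exists N0, forall N, (N0 <= N)%N -> (G * N.+1 <= 2 ^ (N %/ j))%N.
Proof.
move=> j0; exists (2 * j * (2 * j * G))%N => N leN.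
have j2 : (0 < 2 * j)%N by rewrite muln_gt0.
set t := (N %/ (2 * j))%N.
have Gt : (2 * j * G <= t)%N by rewrite /t leq_divRL // mulnC.
have tN : (N.+1 <= 2 * j * t.+1)%N by rewrite mulnC; apply: ltn_ceil.
have t2 : (2 * t <= N %/ j)%N.
  by rewrite leq_divRL // (mulnC 2 t) -mulnA; apply: leq_trunc_div.
have exp2 : (t < 2 ^ t)%N by apply: ltn_expl.
apply: (@leq_trans (2 ^ (2 * t))); last by rewrite leq_exp2l.
apply: (@leq_trans (t.+1 * t.+1)).
  move: tN Gt; move: (2 * j)%N => J; clear; nia.
by rewrite mulnC expnM mulnn leq_exp2r.
Qed.

(** The last factor bounds [1 + D/n] for [a = q]. Its gap to 3/2 leaves room for two small factors:
    one pays for the number of vertices, the other for the accumulated error. *)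
Lemma base_ratio_le (F : realFieldType) (a : F) : 1 <= a ->
  (1 + (24 * a + 6)^-1) * (1 + (24 * a + 6)^-1) * ((6 * a + 1) / (4 * a + 1)) <= 3 / 2.
Proof.
move=> a1; have a4 : 0 < 4 * a + 1 by lra.
have a24 : 0 < 24 * a + 6 by lra.
rewrite -subr_ge0.
have -> : 3 / 2 - (1 + (24 * a + 6)^-1) * (1 + (24 * a + 6)^-1) * ((6 * a + 1) / (4 * a + 1)) =
    (36 * a + 10) / (2 * (24 * a + 6) ^+ 2 * (4 * a + 1)).
  by field; rewrite (gt_eqF a4) (gt_eqF a24).
have a36 : 0 <= 36 * a + 10 by lra.
by rewrite divr_ge0 // mulr_ge0 ?(ltW a4) // mulr_ge0 // exprn_ge0 // ltW.
Qed.

Lemma parameters (F : realFieldType) (k q : nat) : (0 < k)%N -> (0 < q)%N ->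
  exists r0 : nat, forall r D : nat, (r0 <= r)%N -> ((2 * q + 1) * D <= q * r)%N ->
  exists m N : nat,
  let M := (4 * (2 * q + 1) ^ k * m)%N in
  let n := (r - k * M)%N in
  [/\ [/\ (0 < m)%N, (m <= n)%N, (0 < N)%N & (2 * k * N <= m)%N],
      (k * M <= r)%N, ((4 * q + 1) * D <= 2 * q * n)%N, ((k * r) ^ k < 2 ^ m)%N
    & (k * r)%:R * (1 + 2 * ((k * N)%:R / m%:R) ^+ 2) ^+ n * (1 + D%:R / n%:R) ^+ N
    <= (3 / 2) ^+ N :> F].
Proof.
move=> k0 q0; set Q := ((2 * q + 1) ^ k)%N.
have Q0 : (0 < Q)%N by rewrite expn_gt0 addn1.
have [w wdef] : exists w, w = (24 * q + 6)%N by eexists.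
(* [C] makes [(4 * q + 2) * (k * M)] equal to [R * N], so absorbers use at most a fraction
   [1 / (4 * q + 2)] of each class. That is half the slack in the degree condition, in the sense of
   [Dn]. *)
have [C CE] : exists C, C = ((4 * q + 2) * (8 * Q * k * k))%N by eexists.
have [s sE] : exists s, s = (C * w.+1)%N by eexists.
have [R RE] : exists R, R = (C * s)%N by eexists.
have C0 : (0 < C)%N by rewrite CE !muln_gt0 addn2 k0 Q0.
have s0 : (0 < s)%N by rewrite sE muln_gt0 C0.
have R0 : (0 < R)%N by rewrite RE muln_gt0 C0.
have [N0 hN0] := @linear_le_exp2 (k * R) w.+1 isT.
(* With m = 2 k s N the growth factor of the potential is 1 + 1/(2 s^2) per step,
   and there are at most 2 R N steps with R / s^2 = 1 / (w + 1). *)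
exists (R * N0.+1)%N => r D rR Dr.
have [N NE] : exists N, N = (r %/ R)%N by eexists.
have NN0 : (N0 < N)%N by rewrite NE leq_divRL // mulnC.
have N1 : (0 < N)%N by apply: leq_ltn_trans NN0.
have rN : (R * N <= r)%N by rewrite NE mulnC; apply: leq_trunc_div.
have rN1 : (r < R * N.+1)%N by rewrite NE mulnC; apply: ltn_ceil.
pose m := (2 * k * s * N)%N; exists m, N; move=> M n.
have kM : ((4 * q + 2) * (k * M))%N = (R * N)%N.
  by rewrite /M /m RE CE; ring.
have kMr : ((4 * q + 2) * (k * M) <= r)%N by rewrite kM.
have m0 : (0 < m)%N by rewrite !muln_gt0 k0 s0.
have mM : (m <= k * M)%N by rewrite /M mulnA leq_pmull // muln_gt0 k0 muln_gt0.
have kMr' : (k * M <= r)%N.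
  by apply: leq_trans kMr; rewrite leq_pmull // addn2.
have rn : ((4 * q + 1) * r <= (4 * q + 2) * n)%N.
  rewrite /n mulnBr; move: kMr; move: (k * M)%N => X; clear; lia.
have Dn : ((4 * q + 1) * D <= 2 * q * n)%N.
  have h1 : ((2 * q + 1) * ((4 * q + 1) * D) <= q * ((4 * q + 1) * r))%N.
    by rewrite mulnCA (mulnCA q) leq_mul2l Dr orbT.
  have h2 : (q * ((4 * q + 1) * r) <= q * ((4 * q + 2) * n))%N by rewrite leq_mul2l rn orbT.
  have : ((2 * q + 1) * ((4 * q + 1) * D) <= (2 * q + 1) * (2 * q * n))%N.
    by apply: leq_trans h1 (leq_trans h2 _); rewrite mulnA [leqRHS]mulnA leq_mul2r; apply/orP; right; lia.
  by rewrite leq_mul2l addn1.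
have mn : (m <= n)%N.
  have : ((4 * q + 1) * (k * M) <= n)%N by rewrite /n; move: kMr; move: (k * M)%N => X; clear; lia.
  by apply: leq_trans; apply: leq_trans mM _; rewrite leq_pmull // addn1.
have kr : (k * r <= 2 ^ (N %/ w.+1))%N.
  by apply: leq_trans (hN0 N (ltnW NN0)); rewrite -mulnA leq_mul2l ltnW // orbT.
have n0 : (0 < n)%N by apply: leq_trans mn.
split=> //.
- by split=> //; rewrite /m -[leqRHS]mulnA leq_mul2l leq_pmull // orbT.
- apply: (@leq_ltn_trans (2 ^ (N * k))).
    rewrite expnM leq_exp2r //; apply: leq_trans kr _.
    by rewrite leq_exp2l // leq_div.
  by rewrite ltn_exp2l // /m; move: k0 s0 N1; clear; nia.
pose x : F := w%:R^-1.
have wE : w%:R = 24 * q%:R + 6 :> F by rewrite wdef natrD natrM.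
have qR : 1 <= q%:R :> F by rewrite ler1n.
have w0 : 0 < w%:R :> F by rewrite wE; lra.
have x0 : 0 < x by rewrite invr_gt0.
have E1 : (1 + 2 * ((k * N)%:R / m%:R) ^+ 2) = 1 + (2 * s%:R ^+ 2)^-1 :> F.
  congr (_ + _); rewrite /m !natrM; field.
  by rewrite !pnatr_eq0 -!lt0n k0 s0 N1.
rewrite E1.
have B1 : (k * r)%:R <= (1 + x) ^+ N.
  apply: (@le_trans _ _ (2 ^+ (N %/ w.+1))).
    by rewrite -natrX ler_nat.
  have h2 : 2 <= (1 + x) ^+ w.+1.
    have := expn_pred_double (ltn0Sn w); rewrite -(ler_nat F) natrM !natrX /= => h.
    have -> : 1 + x = w.+1%:R / w%:R.
      by rewrite /x -natr1; field; rewrite gt_eqF.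
    by rewrite expr_div_n ler_pdivlMr // exprn_gt0.
  apply: (@le_trans _ _ (((1 + x) ^+ w.+1) ^+ (N %/ w.+1))).
    by apply: lerXn2r; rewrite ?nnegrE //; apply: le_trans h2.
  rewrite -exprM; apply: ler_weXn2l; first lra.
  by rewrite mulnC leq_trunc_div.
have B2 : (1 + (2 * s%:R ^+ 2)^-1) ^+ n <= (1 + x) ^+ N.
  pose b : F := (2 * s%:R ^+ 2)^-1.
  have b0 : 0 < b by rewrite invr_gt0 mulr_gt0 ?exprn_gt0 ?ltr0n.
  (* At [j = 2 * R] the first factor is [1 - 1/(w + 1)], the inverse of [1 + x]. Since
     [n <= r < R * N.+1 <= 2 * R * N], the growth over [n] steps is at most [(1 + x) ^+ N]. *)
  have bern j : (1 - j%:R * b) * (1 + b) ^+ j <= 1.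
    elim: j => [|j IH]; first by rewrite mul0r subr0 mul1r expr0.
    apply: le_trans IH; rewrite exprS mulrA; apply: ler_wpM2r.
      by rewrite exprn_ge0 //; lra.
    by rewrite -natr1; have : 0 <= j%:R :> F by []; nra.
  have h2 : (1 + b) ^+ (2 * R) <= 1 + x.
    have := bern (2 * R)%N.
    have -> : 1 - (2 * R)%:R * b = (1 + x)^-1.
      rewrite /b RE sE /x -(addn1 w) !natrM natrD.
      have : 0 < C%:R :> F by rewrite ltr0n.
      move: w0; move: w%:R C%:R; clear => a c a0 c0.
      by field; rewrite !gt_eqF //; lra.
    have x1 : 0 < 1 + x by lra.
    by rewrite [(1 + x)^-1 * _]mulrC ler_pdivrMr // mul1r.
  apply: (@le_trans _ _ (((1 + b) ^+ (2 * R)) ^+ N)).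
    rewrite -/b -exprM; apply: ler_weXn2l; first lra.
    by apply: leq_trans (leq_subr _ _) _; move: rN1 N1; clear; nia.
  by apply: lerXn2r; rewrite ?nnegrE ?exprn_ge0 //; lra.
have B3 : (1 + D%:R / n%:R) <= (6 * q%:R + 1) / (4 * q%:R + 1) :> F.
  have nR : 0 < n%:R :> F by rewrite ltr0n.
  have q4 : 0 < 4 * q%:R + 1 :> F by lra.
  have -> : (6 * q%:R + 1) / (4 * q%:R + 1) = 1 + (2 * q%:R) / (4 * q%:R + 1) :> F.
    by field; rewrite gt_eqF.
  rewrite lerD2l ler_pdivrMr // mulrAC ler_pdivlMr //.
  by move: Dn; rewrite -(ler_nat F) !(natrM, natrD); lra.
have B4 := base_ratio_le qR; rewrite -wE -/x in B4.
have D0 : 0 <= 1 + D%:R / n%:R :> F by rewrite addr_ge0 // divr_ge0 ?ler0n.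
have x1 : 0 <= 1 + x by lra.
have y0 : 0 <= (6 * q%:R + 1) / (4 * q%:R + 1) :> F.
  by apply: divr_ge0; rewrite addr_ge0 ?mulr_ge0 ?ler0n.
apply: (@le_trans _ _ (((1 + x) * (1 + x) * ((6 * q%:R + 1) / (4 * q%:R + 1))) ^+ N)); last first.
  apply: lerXn2r => //; rewrite nnegrE; last lra.
  by apply: mulr_ge0 y0; apply: mulr_ge0.
rewrite exprMn [((1 + x) * (1 + x)) ^+ N]exprMn; apply: ler_pM.
- by rewrite mulr_ge0 ?ler0n // exprn_ge0 // addr_ge0 // invr_ge0 mulr_ge0 // exprn_ge0 // ler0n.
- exact: exprn_ge0.
- apply: ler_pM => //.
  by rewrite exprn_ge0 // addr_ge0 // invr_ge0 mulr_ge0 // exprn_ge0 // ler0n.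
- by apply: lerXn2r; rewrite ?nnegrE.
Qed.

Local Close Scope ring_scope.
From Stdlib Require Import Reals.

Theorem theorem1p4 :
  forall k : nat, (3 <= k)%N ->
  forall eps : R, (0 < eps)%R ->
  exists r0 : nat, forall r : nat, (r0 <= r)%N ->
  forall (T : finType) (e : rel T) (part : T -> 'I_k),
    simple_graph e ->
    (forall i : 'I_k, #|part_class part i| = r) ->
    (INR r >= (2 + eps) * INR (maxdeg e))%R ->
    exists Q : {set {set T}}, IT_partition e part Q.
Proof.
move=> k k3 eps eps0.
have k0 : (0 < k)%N by apply: leq_trans k3.
(* Any [q] with [1/q < eps] turns the real degree condition into the integer inequality
   [(2 * q + 1) * D <= q * r]. *)
have [q [qeps q0]] := archimed_cor1 eps eps0.
move/ssrnat.ltP: (q0) => q0'.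
have [r0 hr0] := parameters rat k0 q0'.
exists r0 => r rr0 T e part [esym eirr] sizeT degR.
pose D := maxdeg e.
have degD v : (#|nbr e v| <= D)%N by apply: (leq_bigmax (F := deg e)).
have Dr : ((2 * q + 1) * D <= q * r)%N.
  apply/ssrnat.leP/INR_le; rewrite !mult_INR plus_INR mult_INR /=.
  have qR : (0 < INR q)%R by apply: lt_0_INR.
  have D0 : (0 <= INR D)%R by apply: pos_INR.
  have qe : (1 <= INR q * eps)%R.
    have := Rmult_lt_compat_l _ _ _ qR qeps; rewrite Rinv_r; last by apply: Rgt_not_eq.
    exact: Rlt_le.
  have := Rmult_ge_compat_l (INR q) _ _ (Rle_ge _ _ (Rlt_le _ _ qR)) degR; rewrite -/D.
  have := Rmult_le_compat_r (INR D) _ _ D0 qe.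
  by move=> ? ?; Lra.lra.
have [m [N]] := hr0 r D rr0 Dr.
move=> [[m0 mn N0 kNm] kMr Dn small1 small2].
have sizeT' i : #|class part setT i| = r.
  by rewrite -(sizeT i); apply: eq_card => v; rewrite !inE.
have cT : #|T| = (k * r)%N by rewrite -cardsT (card_classes sizeT') card_ord.
have pack : packing e part r setT.
  apply: (@packing_setT T 'I_k e part D r q m N esym eirr); rewrite ?card_ord ?cT //.
have kI : (0 < #|'I_k|)%N by rewrite card_ord.
have [Q QT ITQ] := packing_partition kI pack.
exists Q; split=> // S /ITQ IS; case/is_ITP: (IS) => _ Sind _ _; split=> // i.
have := card_class_IT i IS; rewrite inE /= => <-.
by apply: eq_card => v; rewrite !inE.
Qed.
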